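(* Let $n\ge1$, let $\Phi:\mathcal{D}\to\mathbb{CP}^n$ be an admissible analytic curve on the open unit disc with lifting $f:\mathcal{D}\to\mathbb{C}^{n+1}\setminus\{0\}$ such that $f,f',\ldots,f^{(n)}$ are pointwise linearly independent, and let $\lambda:\mathcal{D}\to\mathbb{C}\setminus\{0\}$ be holomorphic with $\lambda^{n+1}\det[f,f',\ldots,f^{(n)}]=1$. Let $g_0,\ldots,g_n$ be the functions on $\mathcal{D}$ determined by $$f^{(n+1)}=g_0f+g_1f'+\cdots+g_nf^{(n)}.$$ Let $H$ be the $(n+1)\times(n+2)$ matrix with rows indexed by $i=0,\ldots,n$ and columns indexed by $m=0,\ldots,n+1$, with entries $$H_{i,m}=\binom{m}{i}\lambda^{(m-i)}\ \text{ if } i\le m\le n,\qquad H_{i,m}=0\ \text{ if } m<i,\qquad H_{i,n+1}=\binom{n+1}{i}\lambda^{(n+1-i)}+\lambda g_i .$$ For $0\le j\le n-1$ let $H_j$ be the $(n+1)\times(n+1)$ matrix obtained from $H$ by deleting its $(j+1)$st column (the column indexed by $m=j$). Then the Schwarzian curvatures of $\Phi$ are given by $$\kappa_j=(-1)^{n-j}\,\det H_j\cdot\det[f,f',\ldots,f^{(n)}],\qquad j=0,\ldots,n-1 .$$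
   Context: An analytic curve $\Phi:\mathcal{D}\to\mathbb{CP}^n$ is called admissible if it has a holomorphic lifting $f:\mathcal{D}\to\mathbb{C}^{n+1}\setminus\{0\}$ (i.e. $\Phi(z)=[f(z)]$) such that $f(z),f'(z),\ldots,f^{(n)}(z)$ are linearly independent for every $z\in\mathcal{D}$. With $\lambda$ holomorphic and nowhere zero such that $\lambda^{n+1}\det[f,f',\ldots,f^{(n)}]=1$ (vectors written as columns), put $\nu=\lambda f$, so that $\det[\nu,\nu',\ldots,\nu^{(n)}]=1$. Differentiating gives $\det[\nu,\nu',\ldots,\nu^{(n-1)},\nu^{(n+1)}]=0$, so there are unique holomorphic functions $\kappa_0,\ldots,\kappa_{n-1}$ on $\mathcal{D}$ with $$\nu^{(n+1)}=\kappa_0\nu+\kappa_1\nu'+\cdots+\kappa_{n-1}\nu^{(n-1)}.$$ These are the Schwarzian curvatures of $\Phi$ (they do not depend on the choice of $f$ and $\lambda$). *)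

(* Defs.v *)
(* MathComp-Analysis, with the complex numbers R[i] of real-closed. *)
From HB Require Import structures.
From mathcomp Require Import all_boot all_order all_algebra.
From mathcomp Require Import all_classical all_reals all_analysis.
From mathcomp Require Import complex.
Set Implicit Arguments.
Unset Strict Implicit.
Unset Printing Implicit Defensive.
Import Order.TTheory GRing.Theory Num.Theory numFieldNormedType.Exports.
Local Open Scope ring_scope.
Local Open Scope classical_set_scope.

(* R[i], packed as a numClosedFieldType so that it carries the topology and the
   normed module structure (over itself) given by its norm. *)
Definition Cplx (R : realType) : numClosedFieldType := R[i].

Definition unit_disc (R : realType) : set (Cplx R) := [set z | `|z| < 1].
Arguments unit_disc : clear implicits.

(* Functions on the disc are total functions on the plane, of which only the
   values on the disc matter. In h^-1 *: (f (h *: 1 + z) - f z) the increment h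
   is a complex number, so derivability along 1 is complex differentiability;
   likewise derive1n k f is the k-th complex derivative. *)
Definition holomorphic (R : realType) (W : normedModType (Cplx R))
    (f : Cplx R -> W) : Prop :=
  forall z, unit_disc R z -> derivable f z 1.

(* Points of CP^n are the lines of C^{n+1}. *)
Definition CP (R : realType) (n : nat) : Type :=
  {L : {vspace 'cV[Cplx R]_n.+1} | \dim L == 1%N}.

Definition lifting (R : realType) (n : nat) (Phi : Cplx R -> CP R n)
    (f : Cplx R -> 'cV[Cplx R]_n.+1) : Prop :=
  holomorphic f /\
  forall z, unit_disc R z -> f z != 0 /\ val (Phi z) = <[f z]>%VS.

(* The curve Phi is admissible when it has such a lifting. *)
Definition admissible_lifting (R : realType) (n : nat) (Phi : Cplx R -> CP R n)
    (f : Cplx R -> 'cV[Cplx R]_n.+1) : Prop :=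
  lifting Phi f /\
  forall z, unit_disc R z -> free [seq derive1n k f z | k <- iota 0 n.+1].

(* [f, f', ..., f^(n)], as columns *)
Definition wronskian_mx (R : realType) (n : nat)
    (f : Cplx R -> 'cV[Cplx R]_n.+1) (z : Cplx R) : 'M[Cplx R]_n.+1 :=
  \matrix_(i < n.+1, k < n.+1) derive1n k f z i 0.

Definition normalizing_factor (R : realType) (n : nat)
    (f : Cplx R -> 'cV[Cplx R]_n.+1) (lambda : Cplx R -> Cplx R) : Prop :=
  holomorphic lambda /\
  forall z, unit_disc R z ->
    lambda z != 0 /\ lambda z ^+ n.+1 * \det (wronskian_mx f z) = 1.

Definition is_schwarzian_curvatures (R : realType) (n : nat)
    (Phi : Cplx R -> CP R n) (kappa : 'I_n -> Cplx R -> Cplx R) : Prop :=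
  (forall j, holomorphic (kappa j)) /\
  exists (f : Cplx R -> 'cV[Cplx R]_n.+1) (lambda : Cplx R -> Cplx R),
    [/\ admissible_lifting Phi f, normalizing_factor f lambda &
      let nu : Cplx R -> 'cV[Cplx R]_n.+1 := fun w => lambda w *: f w in
      forall z, unit_disc R z ->
        derive1n n.+1 nu z = \sum_(j < n) kappa j z *: derive1n j nu z].

(* The curvatures are unique on the disc and do not depend on the choice of f
   and lambda; here they are picked by choice, and are 0 if none exist. *)
Definition schwarzian_curvature (R : realType) (n : nat)
    (Phi : Cplx R -> CP R n) : 'I_n -> Cplx R -> Cplx R :=
  xget (fun _ _ => 0) [set kappa | is_schwarzian_curvatures Phi kappa].

Definition H_mx (R : realType) (n : nat) (lambda : Cplx R -> Cplx R)
    (g : 'I_n.+1 -> Cplx R -> Cplx R) (z : Cplx R) :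
    'M[Cplx R]_(n.+1, n.+2) :=
  \matrix_(i < n.+1, m < n.+2)
    if (m <= n)%N then
      if (i <= m)%N then 'C(m, i)%:R * derive1n (m - i)%N lambda z else 0
    else 'C(n.+1, i)%:R * derive1n (n.+1 - i)%N lambda z + lambda z * g i z.

(* H with its column of index j (counted from 0) deleted *)
Definition H_minor (R : realType) (n : nat) (lambda : Cplx R -> Cplx R)
    (g : 'I_n.+1 -> Cplx R -> Cplx R) (j : 'I_n) (z : Cplx R) :
    'M[Cplx R]_n.+1 :=
  col' (inord j : 'I_n.+2) (H_mx lambda g z).

(* Main.v *)
Require Import Defs.
From HB Require Import structures.
From mathcomp Require Import all_boot all_order all_algebra perm.
From mathcomp Require Import all_classical all_reals all_analysis.
From mathcomp Require Import complex.
From mathcomp Require Import ring lra.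
Set Implicit Arguments.
Unset Strict Implicit.
Unset Printing Implicit Defensive.
Import Order.TTheory GRing.Theory Num.Theory numFieldNormedType.Exports.
Local Open Scope ring_scope.
Local Open Scope classical_set_scope.

(* By the Leibniz rule the derivatives of nu = lambda f satisfy
   [nu, ..., nu^(n+1)] = [f, ..., f^(n)] H. Deleting column j and substituting
   nu^(n+1) = sum_k kappa_k nu^(k), only the term of kappa_j survives on the left
   and det [nu, ..., nu^(n)] = 1, which gives the formula.

   The curvatures are defined by choice, so they must also be shown to exist and
   to be independent of the lift. For existence, nu^(n+1) is expanded by Cramer's
   rule: the coefficient of nu^(n) vanishes because it is the derivative of
   det [nu, ..., nu^(n)], and the others are polynomials in derivatives of nu.
   That these derivatives are holomorphic rests on Goursat's theorem, proved here
   by bisection, and on Cauchy's formula. For independence, two normalized lifts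
   differ by a holomorphic mu with mu ^+ n.+1 = 1, hence mu' = 0. *)

(** Holomorphy here means that a complex derivative exists at each point of the disc; its continuity
    is not part of the definition. Green's theorem is therefore out of reach, and even the Leibniz
    rule for [derive1n] already needs Goursat, since it differentiates derivatives. The analytic
    half aims at one fact, [derivable_derive1]: the derivative of a holomorphic function is
    derivable. Everything after it is induction and linear algebra, without power series. Complex
    integrals are split into real and imaginary parts, and a closed curve is the image of a
    rectangle of real parameters. Goursat is thus proved for real forms P dx + Q dy on rectangles
    with sides parallel to the axes, the only domains on which integrals are taken. *)

Section SegmentIntegral.
Variable R : realType.
Implicit Types (a b c M : R) (g : R -> R).

(** * Real integrals over a segment *)

Definition itg a b g : R := (\int[@lebesgue_measure R]_(x in `[a, b]) g x)%R.

(** Continuity is two-sided even at the endpoints, so it restricts to subsegments at once and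
    composes with functions on the plane. *)
Definition cont_on a b g := forall x, a <= x <= b -> {for x, continuous g}.

Lemma cont_on_integrable a b g : cont_on a b g ->
  (@lebesgue_measure R).-integrable `[a, b] (EFin \o g).
Proof.
move=> cg; apply: continuous_compact_integrable; first exact: segment_compact.
apply: continuous_in_subspaceT => x; rewrite inE /= in_itv /= => xab.
exact: cg.
Qed.

Lemma itg_cst a b c : a <= b -> itg a b (fun=> c) = c * (b - a).
Proof.
move=> ab; rewrite /itg Rintegral_cst//; set m := (X in fine X).
have -> : m = lebesgue_measure `[a, b]%classic by [].
rewrite lebesgue_measure_itv/= lte_fin.
by case: ltgtP ab => //= -> _; rewrite subrr.
Qed.

Lemma itgB a b g1 g2 : cont_on a b g1 -> cont_on a b g2 ->
  itg a b (fun x => g1 x - g2 x) = itg a b g1 - itg a b g2.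
Proof. by move=> c1 c2; rewrite /itg RintegralB//; exact: cont_on_integrable. Qed.

Lemma itgD a b g1 g2 : cont_on a b g1 -> cont_on a b g2 ->
  itg a b (fun x => g1 x + g2 x) = itg a b g1 + itg a b g2.
Proof. by move=> c1 c2; rewrite /itg RintegralD//; exact: cont_on_integrable. Qed.

Lemma itgZ a b c g : cont_on a b g ->
  itg a b (fun x => c * g x) = c * itg a b g.
Proof. by move=> cg; rewrite /itg RintegralZl//; exact: cont_on_integrable. Qed.

Lemma eq_itg a b g1 g2 : (forall x, a <= x <= b -> g1 x = g2 x) ->
  itg a b g1 = itg a b g2.
Proof.
move=> e; apply: eq_Rintegral => x; rewrite inE /= in_itv /=; exact: e.
Qed.

Lemma itg_bound a b g M : a <= b -> cont_on a b g ->
  (forall x, a <= x <= b -> `|g x| <= M) -> `|itg a b g| <= M * (b - a).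
Proof.
move=> ab cg gM; rewrite -(itg_cst M ab).
apply: le_trans (le_normr_Rintegral _ (cont_on_integrable cg)) _ => //.
apply: le_Rintegral => //.
- apply: (@cont_on_integrable _ _ (fun x => `|g x|)) => x xab.
  apply: (continuous_comp (cg x xab)); exact: norm_continuous.
- by apply: (@cont_on_integrable _ _ (fun=> M)) => x _; exact: cvg_cst.
Qed.

Lemma itg_split a b c g : a <= c -> c <= b -> cont_on a b g ->
  itg a b g = itg a c g + itg c b g.
Proof.
move=> ac cb cg; apply/eqP; rewrite addrC -subr_eq; apply/eqP.
have ig := cont_on_integrable cg.
rewrite /itg [LHS](@Rintegral_itvB R g (BLeft a) (BRight b) c)//.
rewrite Rintegral_itv_obnd_cbnd//.
apply: integrableS ig => //; apply: subset_itvr; by rewrite bnd_simp.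
Qed.

(** * Bisection of rectangles *)

Lemma nested_intervals (u d : nat -> R) : (forall n, 0 <= d n) ->
  (forall n, u n <= u n.+1) -> (forall n, u n.+1 + d n.+1 <= u n + d n) ->
  exists p, forall n, u n <= p <= u n + d n.
Proof.
move=> d0 uS vS.
have um : {homo u : m n / (m <= n)%N >-> m <= n} by exact: homo_leq le_trans uS.
have vm : {homo (fun n => u n + d n) : m n / (m <= n)%N >-> n <= m}.
  by apply: homo_leq => //= x y z xy yz; exact: le_trans yz xy.
have uv m n : u m <= u n + d n.
  have [mn|/ltnW nm] := leqP m n.
    by apply: le_trans (um _ _ mn) _; rewrite lerDl.
  by apply: le_trans _ (vm _ _ nm); rewrite lerDl.
(* By [uv], every right end bounds every left end. *)
exists (sup (range u)) => n; apply/andP; split.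
  apply: ub_le_sup; last by exists n.
  by exists (u 0%N + d 0%N) => _ [m _ <-].
apply: ge_sup; first by exists (u 0%N); exists 0%N.
by move=> _ [m _ <-].
Qed.

(** If the property failed, some quarter would fail, then a quarter of that quarter, and so on; the
    nested bad rectangles close down on a point (p, q), where the local hypothesis contradicts them.
    The sides are [al * h] and [be * h] with fixed [al], [be], so a single parameter [h] records the
    size and is halved at each stage. *)
Lemma rectangle_bisection (al be : R) (Pr : R -> R -> R -> Prop) (x0 y0 : R) :
  0 <= al -> 0 <= be ->
  (forall x y h, 0 < h -> x0 <= x -> x + al * h <= x0 + al ->
     y0 <= y -> y + be * h <= y0 + be ->
     Pr x y (h / 2) -> Pr (x + al * (h / 2)) y (h / 2) ->
     Pr x (y + be * (h / 2)) (h / 2) ->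
     Pr (x + al * (h / 2)) (y + be * (h / 2)) (h / 2) -> Pr x y h) ->
  (forall p q, x0 <= p <= x0 + al -> y0 <= q <= y0 + be ->
     exists2 delta, 0 < delta & forall x y h, 0 < h < delta ->
       x0 <= x -> x + al * h <= x0 + al -> y0 <= y -> y + be * h <= y0 + be ->
       x <= p <= x + al * h -> y <= q <= y + be * h -> Pr x y h) ->
  Pr x0 y0 1.
Proof.
move=> al0 be0 glue loc; apply: contrapT => nP.
pose h n : R := 2^-1 ^+ n.
have h0 n : 0 < h n by rewrite exprn_gt0// invr_gt0.
have hS n : h n.+1 = h n / 2 by rewrite /h exprSr.
pose half (c v : R) n (v' : R) := v' = v \/ v' = v + c * h n.+1.
pose good n (s s' : R * R) :=
  [/\ half al s.1 n s'.1, half be s.2 n s'.2 & ~ Pr s'.1 s'.2 (h n.+1)].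
(* The default [s m] is never taken: by [goodS], a bad rectangle has a bad quarter. *)
pose fix s n := if n is m.+1 then xget (s m) (good m (s m)) else (x0, y0).
pose inside n := [/\ ~ Pr (s n).1 (s n).2 (h n), x0 <= (s n).1,
  (s n).1 + al * h n <= x0 + al, y0 <= (s n).2 & (s n).2 + be * h n <= y0 + be].
have goodS n : inside n -> good n (s n) (s n.+1).
  move=> [nPs xa xb ya yb]; apply: xgetPex; apply: contrapT => ng; apply: nPs.
  have gp x y : half al (s n).1 n x -> half be (s n).2 n y -> Pr x y (h n / 2).
    rewrite -hS => hx hy; apply: contrapT => nPxy; apply: ng.
    by exists (x, y).
  by apply: glue => //; apply: gp; rewrite /half -?hS; [left|left|right|left|left|right|right|right].
have halfP c v n v' : 0 <= c -> half c v n v' ->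
    v <= v' /\ v' + c * h n.+1 <= v + c * h n.
  move=> c0; have ch : 0 <= c * h n.+1 by rewrite mulr_ge0// ltW.
  have -> : c * h n = c * h n.+1 + c * h n.+1 by rewrite hS; field.
  by case=> ->; lra.
have ins n : inside n.
  elim: n => [|n IH]; first by rewrite /inside /= /h expr0 !mulr1.
  have [/(halfP _ _ _ _ al0)[? ?] /(halfP _ _ _ _ be0)[? ?] nPS] := goodS n IH.
  by have [_ ? ? ? ?] := IH; split=> //; lra.
have ch0 c : 0 <= c -> forall n, 0 <= c * h n.
  by move=> c0 n; rewrite mulr_ge0// ltW.
have [p pP] : exists p, forall n, (s n).1 <= p <= (s n).1 + al * h n.
  apply: nested_intervals; [exact: ch0| |];
  by move=> n; have [/(halfP _ _ _ _ al0)[]] := goodS n (ins n).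
have [q qP] : exists q, forall n, (s n).2 <= q <= (s n).2 + be * h n.
  apply: nested_intervals; [exact: ch0| |];
  by move=> n; have [_ /(halfP _ _ _ _ be0)[]] := goodS n (ins n).
have [] := loc p q.
- by have := pP 0%N; rewrite /= /h expr0 mulr1.
- by have := qP 0%N; rewrite /= /h expr0 mulr1.
move=> delta delta0 locP.
have : h n @[n --> \oo] --> (0 : R).
  apply: cvg_expr; rewrite ger0_norm ?invr_ge0//; lra.
move/cvgrPdist_lt => /(_ _ delta0)[N _ /(_ N (leqnn N))].
rewrite /= sub0r normrN gtr0_norm// => hN.
have [nPs ? ? ? ?] := ins N.
by apply: nPs; apply: locP; rewrite // h0.
Qed.

End SegmentIntegral.

(** * Goursat's theorem for real differential forms on a rectangle *)

Section RealGoursat.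
Variable R : realType.
Implicit Types (x y h e : R) (F P Q : R * R -> R).

(** The counterclockwise integral of P dx + Q dy along the boundary of the rectangle with lower left
    corner (x, y) and sides [al * h], [be * h]. *)
Definition loop_itg P Q (al be x y h : R) : R :=
  itg x (x + al * h) (fun s => P (s, y))
  + itg y (y + be * h) (fun t => Q (x + al * h, t))
  - itg x (x + al * h) (fun s => P (s, y + be * h))
  - itg y (y + be * h) (fun t => Q (x, t)).

Definition in_rect (x0 y0 al be : R) (p : R * R) :=
  x0 <= p.1 <= x0 + al /\ y0 <= p.2 <= y0 + be.

Definition near_affine F (p : R * R) (a b e : R) (q : R * R) :=
  `|F q - F p - a * (q.1 - p.1) - b * (q.2 - p.2)|
    <= e * (`|q.1 - p.1| + `|q.2 - p.2|).

(* The affine part of the form is closed, since the coefficient b is shared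
   between dP/dy and dQ/dx, so on a rectangle of size h only an error of order
   e * h ^ 2 remains; bisection turns this local bound into a global one. *)
Lemma loop_itg_closed P Q (x0 y0 al be : R) : 0 <= al -> 0 <= be ->
  (forall p, in_rect x0 y0 al be p ->
     {for p, continuous P} /\ {for p, continuous Q}) ->
  (forall p, in_rect x0 y0 al be p -> exists a b c, forall e, 0 < e ->
     \forall q \near p, near_affine P p a b e q /\ near_affine Q p b c e q) ->
  loop_itg P Q al be x0 y0 1 = 0.
Proof.
move=> al0 be0 cPQ loc.
have lineH F y x1 x2 : (forall p, in_rect x0 y0 al be p -> {for p, continuous F}) ->
    x0 <= x1 -> x2 <= x0 + al -> y0 <= y <= y0 + be ->
    cont_on x1 x2 (fun s => F (s, y)).
  move=> cF x01 x2a yb s sx.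
  apply: (@continuous_comp _ _ _ (fun s : R => (s, y)) F).
    exact: (cvg_pair cvg_id (cvg_cst _)).
  by apply: cF; split => /=; move: sx yb; lra.
have lineV F x y1 y2 : (forall p, in_rect x0 y0 al be p -> {for p, continuous F}) ->
    y0 <= y1 -> y2 <= y0 + be -> x0 <= x <= x0 + al ->
    cont_on y1 y2 (fun t => F (x, t)).
  move=> cF y01 y2a xb s sy.
  apply: (@continuous_comp _ _ _ (fun t : R => (x, t)) F).
    exact: (cvg_pair (cvg_cst _) cvg_id).
  by apply: cF; split => /=; move: sy xb; lra.
have cP p hp := (cPQ p hp).1.
have cQ p hp := (cPQ p hp).2.
suff small e : 0 < e -> `|loop_itg P Q al be x0 y0 1| <= e.
  apply/eqP; rewrite -normr_le0 leNgt; apply/negP => l0.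
  by have := small (`|loop_itg P Q al be x0 y0 1| / 2); lra.
move=> e0; pose L := al + be; have L0 : 0 <= L by rewrite addr_ge0.
(* The local error below comes out as [e' * (2 * L ^+ 2) * h ^+ 2]; the added 1 keeps the
   denominator positive when [L] is 0. *)
pose e' := e / (2 * L ^+ 2 + 1).
have D0 : 0 < 2 * L ^+ 2 + 1 by rewrite ltr_wpDl// mulr_ge0// sqr_ge0.
have e'0 : 0 < e' by rewrite divr_gt0.
suff : `|loop_itg P Q al be x0 y0 1| <= e * 1 ^+ 2 by rewrite expr1n mulr1.
apply: (@rectangle_bisection R al be
  (fun x y h => `|loop_itg P Q al be x y h| <= e * h ^+ 2)) => //.
  move=> x y h h0 xa xb ya yb l1 l2 l3 l4.
  have ah : 0 <= al * (h / 2) by rewrite mulr_ge0// divr_ge0// ltW.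
  have bh : 0 <= be * (h / 2) by rewrite mulr_ge0// divr_ge0// ltW.
  have hE c z : z + c * (h / 2) + c * (h / 2) = z + c * h by field.
  have ahE : al * h = al * (h / 2) + al * (h / 2) by field.
  have bhE : be * h = be * (h / 2) + be * (h / 2) by field.
  have -> : loop_itg P Q al be x y h =
    loop_itg P Q al be x y (h / 2) + loop_itg P Q al be (x + al * (h / 2)) y (h / 2)
    + loop_itg P Q al be x (y + be * (h / 2)) (h / 2)
    + loop_itg P Q al be (x + al * (h / 2)) (y + be * (h / 2)) (h / 2).
    have sH z : y0 <= z <= y0 + be ->
        itg x (x + al * h) (fun s => P (s, z)) =
        itg x (x + al * (h / 2)) (fun s => P (s, z)) +
        itg (x + al * (h / 2)) (x + al * h) (fun s => P (s, z)).
      by move=> zb; apply: itg_split; [lra|lra|exact: lineH].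
    have sV z : x0 <= z <= x0 + al ->
        itg y (y + be * h) (fun t => Q (z, t)) =
        itg y (y + be * (h / 2)) (fun t => Q (z, t)) +
        itg (y + be * (h / 2)) (y + be * h) (fun t => Q (z, t)).
      by move=> zb; apply: itg_split; [lra|lra|exact: lineV].
    rewrite /loop_itg !hE !sH ?sV; [ring|lra..].
  have -> : e * h ^+ 2 = e * (h / 2) ^+ 2 + e * (h / 2) ^+ 2
      + e * (h / 2) ^+ 2 + e * (h / 2) ^+ 2 by field.
  apply: le_trans (ler_normD _ _) _; apply: lerD => //.
  apply: le_trans (ler_normD _ _) _; apply: lerD => //.
  by apply: le_trans (ler_normD _ _) _; apply: lerD.
move=> p q px qy.
have [a [b [c /(_ e' e'0)]]] := loc (p, q) (conj px qy).
move=> /nbhs_ballP[d /= d0 dP].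
have L1 : 0 < L + 1 by rewrite ltr_wpDl.
(* Such an [h] makes the two sides add up to less than [d], so the rectangle lies in the ball where
   the affine bounds hold. *)
exists (d / (L + 1)); first by rewrite divr_gt0.
move=> x y h /andP[h0]; rewrite ltr_pdivlMr// => hd xa xb ya yb xp yq.
have ah : 0 <= al * h by rewrite mulr_ge0// ltW.
have bh : 0 <= be * h by rewrite mulr_ge0// ltW.
have hLd : al * h + be * h < d.
  by apply: le_lt_trans hd; rewrite /L; move: h0 => /ltW; lra.
pose K := e' * (L * h).
have inb s t : x <= s <= x + al * h -> y <= t <= y + be * h ->
    `|P (s, t) - P (p, q) - a * (s - p) - b * (t - q)| <= K /\
    `|Q (s, t) - Q (p, q) - b * (s - p) - c * (t - q)| <= K.
  move=> sx ty; have sp : `|s - p| <= al * h by rewrite ler_norml; lra.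
  have tq : `|t - q| <= be * h by rewrite ler_norml; lra.
  have [|hP hQ] := dP (s, t).
    split; rewrite /= /ball /= distrC; first by apply: le_lt_trans sp _; lra.
    by apply: le_lt_trans tq _; lra.
  split; [apply: le_trans hP _ | apply: le_trans hQ _];
    by rewrite /K ler_pM2l// mulrDl lerD.
have xx : x <= x + al * h <= x + al * h by lra.
have x_x : x <= x <= x + al * h by lra.
have yy : y <= y + be * h <= y + be * h by lra.
have y_y : y <= y <= y + be * h by lra.
(* Between the two horizontal sides the [a] terms cancel pointwise and the [b] terms leave minus [b]
   times the area. The vertical sides, in [HQ], leave plus [b] times the area, so only the errors
   remain in the sum. *)
have HP : `|itg x (x + al * h) (fun s => P (s, y))
    - itg x (x + al * h) (fun s => P (s, y + be * h)) + b * (be * h) * (al * h)|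
    <= K * 2 * (al * h).
  have -> : b * (be * h) * (al * h) = - (- b * (be * h) * (x + al * h - x)) by ring.
  have cP1 : cont_on x (x + al * h) (fun s => P (s, y)) by apply: lineH; lra || exact: cP.
  have cP2 : cont_on x (x + al * h) (fun s => P (s, y + be * h)).
    by apply: lineH; lra || exact: cP.
  have cK k : cont_on x (x + al * h) (fun=> k) by move=> ? _; exact: cvg_cst.
  rewrite -itg_cst ?lerDl// -itgB// -itgB//; last first.
    by move=> s sx; apply: cvgB; [exact: cP1 | exact: cP2].
  rewrite [leRHS](_ : _ = K * 2 * (x + al * h - x)); last by ring.
  apply: itg_bound; first by lra.
    by move=> s sx; apply: cvgB (cK _ _ sx); apply: cvgB; [exact: cP1 | exact: cP2].
  move=> s sx; have sx' : x <= s <= x + al * h by lra.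
  have [h1 _] := inb s y sx' y_y; have [h2 _] := inb s (y + be * h) sx' yy.
  by move: h1 h2; rewrite !ler_norml; lra.
have HQ : `|itg y (y + be * h) (fun t => Q (x + al * h, t))
    - itg y (y + be * h) (fun t => Q (x, t)) - b * (al * h) * (be * h)|
    <= K * 2 * (be * h).
  have -> : b * (al * h) * (be * h) = b * (al * h) * (y + be * h - y) by ring.
  have cQ1 : cont_on y (y + be * h) (fun t => Q (x + al * h, t)).
    by apply: lineV; lra || exact: cQ.
  have cQ2 : cont_on y (y + be * h) (fun t => Q (x, t)).
    by apply: lineV; lra || exact: cQ.
  have cK k : cont_on y (y + be * h) (fun=> k) by move=> ? _; exact: cvg_cst.
  rewrite -itg_cst ?lerDl// -itgB// -itgB//; last first.
    by move=> s sx; apply: cvgB; [exact: cQ1 | exact: cQ2].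
  rewrite [leRHS](_ : _ = K * 2 * (y + be * h - y)); last by ring.
  apply: itg_bound; first by lra.
    by move=> s sx; apply: cvgB (cK _ _ sx); apply: cvgB; [exact: cQ1 | exact: cQ2].
  move=> t ty; have ty' : y <= t <= y + be * h by lra.
  have [_ h1] := inb x t x_x ty'; have [_ h2] := inb (x + al * h) t xx ty'.
  by move: h1 h2; rewrite !ler_norml; lra.
apply: (@le_trans _ _ (K * 2 * (al * h) + K * 2 * (be * h))).
  rewrite /loop_itg; move: HP HQ; rewrite !ler_norml.
  set bb := b * _ * _; set bb' := b * _ * _.
  have -> : bb' = bb by rewrite /bb /bb'; ring.
  by lra.
have -> : K * 2 * (al * h) + K * 2 * (be * h) = e' * (2 * L ^+ 2) * h ^+ 2.
  by rewrite /K /L; ring.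
rewrite ler_pM2r ?exprn_gt0// /e' -mulrA ger_pMr//.
by rewrite mulrC ler_pdivrMr// mul1r lerDl.
Qed.

End RealGoursat.

(** * Difference quotients and quadratic remainders *)

Section Slopes.
Variable K : numFieldType.
Implicit Types (f : K -> K) (z : K).

(** The difference quotient, with its gap at [z] filled by the derivative. The field is arbitrary
    because this serves both for cos and sin over R and for holomorphic functions over C. *)
Lemma derivable_slope f z : derivable f z 1 -> exists phi : K -> K,
  [/\ {for z, continuous phi}, phi z = 'D_1 f z &
      forall w, f w - f z = (w - z) * phi w].
Proof.
move=> df; pose phi w := if w == z then 'D_1 f z else (w - z)^-1 * (f w - f z).
have phiz : phi z = 'D_1 f z by rewrite /phi eqxx.
exists phi; split=> // [|w]; last first.
  rewrite /phi; have [->|wz] := eqVneq w z; first by rewrite !subrr mul0r.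
  by rewrite mulrA divff ?mul1r// subr_eq0.
apply/(@cvgrPdist_lt K K K (nbhs z)) => e e0; rewrite phiz.
move: df => /cvgrPdist_lt /(_ _ e0)[d /= d0 dP].
exists d => //= w wd; rewrite /phi.
have [_|wz] := eqVneq w z; first by rewrite subrr normr0.
have := dP (w - z); rewrite /= sub0r normrN distrC subr_eq0 => /(_ wd wz).
by rewrite [_%:A]mulr1 subrK.
Qed.

(** Integrals with a parameter are differentiated through this criterion: an explicit remainder of
    order 2 replaces a limit under the integral sign. *)
Lemma quadratic_is_derive f z l (M : K) : 0 <= M ->
  (\forall h \near 0, `|f (z + h) - f z - h * l| <= M * `|h| ^+ 2) ->
  is_derive z 1 f l.
Proof.
move=> M0 fl; suff cv : h^-1 *: (f (h *: 1 + z) - f z) @[h --> 0^'] --> l.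
  by apply: DeriveDef; [apply/cvg_ex; exists l | apply/cvg_lim].
have M1 : 0 < M + 1 by rewrite ltr_wpDl.
apply/(cvgrPdist_le _ _) => /= e e0; near=> h.
have h0 : h != 0 by near: h; exact: nbhs_dnbhs_neq.
rewrite [h%:A]mulr1 (addrC h) -[_ *: _]/(_ * _).
have -> : l - h^-1 * (f (z + h) - f z) = - h^-1 * (f (z + h) - f z - h * l).
  by field.
rewrite normrM normrN normfV ler_pdivrMl ?normr_gt0//.
apply: (@le_trans _ _ (M * `|h| ^+ 2)).
  by near: h; apply: nbhs_dnbhs.
rewrite expr2 mulrCA ler_pM2l ?normr_gt0//.
apply: (@le_trans _ _ ((M + 1) * `|h|)); first by rewrite ler_wpM2r// lerDl.
rewrite mulrC -ler_pdivlMr//; near: h; apply: dnbhs0_le.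
by rewrite divr_gt0.
Unshelve. all: by end_near. Qed.

End Slopes.

(** * Integrals of complex functions of a real variable *)

Section ComplexIntegral.
Variable R : realType.
Notation C := (Cplx R).
Implicit Types (a b : R) (g : R -> C) (z w c : C).

Definition rc (x : R) : C := real_complex R x.

Lemma rcD x y : rc (x + y) = rc x + rc y. Proof. exact: rmorphD. Qed.
Lemma rcB x y : rc (x - y) = rc x - rc y. Proof. exact: rmorphB. Qed.
Lemma rcM x y : rc (x * y) = rc x * rc y. Proof. exact: rmorphM. Qed.
Lemma ler_rc x y : (rc x <= rc y) = (x <= y). Proof. exact: lecR. Qed.
Lemma ltr_rc x y : (rc x < rc y) = (x < y). Proof. exact: ltcR. Qed.
Lemma rc_norm x : `|rc x| = rc `|x|.
Proof. by rewrite normc_def /= expr0n addr0 sqrtr_sqr. Qed.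

Lemma Re_sub z w : complex.Re (z - w) = complex.Re z - complex.Re w.
Proof. by case: z; case: w. Qed.
Lemma Im_sub z w : complex.Im (z - w) = complex.Im z - complex.Im w.
Proof. by case: z; case: w. Qed.
Lemma Re_rcM (x : R) z : complex.Re (rc x * z) = x * complex.Re z.
Proof. by case: z => a b /=; rewrite mul0r subr0. Qed.
Lemma Im_rcM (x : R) z : complex.Im (rc x * z) = x * complex.Im z.
Proof. by case: z => a b /=; rewrite mul0r addr0. Qed.

Lemma rc_normRe z : rc `|complex.Re z| <= `|z|.
Proof. exact: normc_ge_Re. Qed.

Lemma rc_normIm z : rc `|complex.Im z| <= `|z|.
Proof.
rewrite normc_def ler_rc -sqrtr_sqr ler_wsqrtr// lerDr; exact: sqr_ge0.
Qed.

(** The order of C only compares numbers with the same imaginary part, so a positive number is real.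
    This turns the radii and epsilons of C into reals. *)
Lemma pos_rc (e : C) : 0 < e -> exists2 r : R, 0 < r & e = rc r.
Proof.
by case: e => r s; rewrite ltcE /= => /andP[/eqP -> r0]; exists r.
Qed.

Lemma continuous_rc : continuous rc.
Proof.
move=> x; apply/(cvgrPdist_lt _ _) => /= _ /pos_rc[e e0 ->]; near=> y.
rewrite -rcB rc_norm ltr_rc; near: y.
by exact: (cvgrPdist_lt (fun y => y : R) x).1 cvg_id _ e0.
Unshelve. all: by end_near. Qed.

Lemma continuous_Re : continuous (@complex.Re R : C -> R).
Proof.
move=> z; apply/(@cvgrPdist_lt R R C (nbhs z)) => e e0; near=> w.
rewrite -Re_sub -ltr_rc; apply: le_lt_trans (rc_normRe _) _; near: w.
by apply: (@cvgrPdist_lt C C C (nbhs z) _ id z).1 cvg_id _ _; rewrite (ltr_rc 0).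
Unshelve. all: by end_near. Qed.

Lemma continuous_Im : continuous (@complex.Im R : C -> R).
Proof.
move=> z; apply/(@cvgrPdist_lt R R C (nbhs z)) => e e0; near=> w.
rewrite -Im_sub -ltr_rc; apply: le_lt_trans (rc_normIm _) _; near: w.
by apply: (@cvgrPdist_lt C C C (nbhs z) _ id z).1 cvg_id _ _; rewrite (ltr_rc 0).
Unshelve. all: by end_near. Qed.

Lemma continuous_ReF (T : topologicalType) (F : T -> C) x :
  {for x, continuous F} -> {for x, continuous (fun y => complex.Re (F y))}.
Proof. by move=> cF; apply: (continuous_comp cF); exact: continuous_Re. Qed.

Lemma continuous_ImF (T : topologicalType) (F : T -> C) x :
  {for x, continuous F} -> {for x, continuous (fun y => complex.Im (F y))}.
Proof. by move=> cF; apply: (continuous_comp cF); exact: continuous_Im. Qed.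

Lemma cont_on_Re a b g : continuous g -> cont_on a b (fun x => complex.Re (g x)).
Proof. by move=> cg x _; apply: continuous_ReF; exact: cg. Qed.

Lemma cont_on_Im a b g : continuous g -> cont_on a b (fun x => complex.Im (g x)).
Proof. by move=> cg x _; apply: continuous_ImF; exact: cg. Qed.

Definition cint a b g : C :=
  Complex (itg a b (fun x => complex.Re (g x))) (itg a b (fun x => complex.Im (g x))).

Lemma cintB a b g1 g2 : continuous g1 -> continuous g2 ->
  cint a b (fun x => g1 x - g2 x) = cint a b g1 - cint a b g2.
Proof.
move=> c1 c2; apply/eqP; rewrite eq_complex Re_sub Im_sub /=; apply/andP; split; apply/eqP.
  rewrite -itgB; try exact: cont_on_Re.
  by apply: eq_itg => x _; rewrite Re_sub.
rewrite -itgB; try exact: cont_on_Im.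
by apply: eq_itg => x _; rewrite Im_sub.
Qed.

Lemma cintZ a b c g : continuous g ->
  cint a b (fun x => c * g x) = c * cint a b g.
Proof.
move=> cg; have cR k : cont_on a b (fun x => k * complex.Re (g x)).
  by move=> x _; apply: cvgM; [exact: cvg_cst | exact/continuous_ReF/cg].
have cI k : cont_on a b (fun x => k * complex.Im (g x)).
  by move=> x _; apply: cvgM; [exact: cvg_cst | exact/continuous_ImF/cg].
have cR' := @cont_on_Re a b g cg; have cI' := @cont_on_Im a b g cg.
case: c => u v; apply/eqP; rewrite eq_complex /=; apply/andP; split; apply/eqP.
  rewrite -!itgZ// -itgB//; by apply: eq_itg => x _; case: (g x).
by rewrite -!itgZ// -itgD//; apply: eq_itg => x _; case: (g x).
Qed.

Lemma eq_cint a b g1 g2 : g1 =1 g2 -> cint a b g1 = cint a b g2.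
Proof. by move=> /funext ->. Qed.

(** The factor 2 comes from bounding the real and imaginary parts separately; any fixed constant
    would serve in the estimates that follow. *)
Lemma cint_bound a b g (M : C) : a <= b -> continuous g ->
  (forall x, a <= x <= b -> `|g x| <= M) -> `|cint a b g| <= 2 * rc (b - a) * M.
Proof.
move=> ab cg gM; have aa : a <= a <= b by rewrite lexx.
have M0 : 0 <= M := le_trans (normr_ge0 _) (gM a aa).
have [m M_m] : exists m, M = rc m.
  by case: M M0 {gM} => m n; rewrite lecE /= => /andP[/eqP -> _]; exists m.
have hR : `|itg a b (fun x => complex.Re (g x))| <= m * (b - a).
  apply: itg_bound => // [x _|x xab]; first exact/continuous_ReF/cg.
  by rewrite -ler_rc -M_m; apply: le_trans (rc_normRe _) (gM x xab).
have hI : `|itg a b (fun x => complex.Im (g x))| <= m * (b - a).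
  apply: itg_bound => // [x _|x xab]; first exact/continuous_ImF/cg.
  by rewrite -ler_rc -M_m; apply: le_trans (rc_normIm _) (gM x xab).
rewrite (complexE (cint a b g)) /=; apply: le_trans (ler_normD _ _) _.
rewrite normrM -[real_complex _ _]/(rc _) -[X in _ * `|X|]/(rc _) !rc_norm.
have -> : `|('i)%C| = 1 :> C.
  by rewrite normc_def /= expr0n /= add0r expr1n sqrtr1.
rewrite mul1r -rcD M_m (_ : 2 * rc (b - a) * rc m = rc (m * (b - a) + m * (b - a))).
  by rewrite ler_rc lerD.
rewrite (rcD (m * (b - a))) rcM; ring.
Qed.

Lemma cint_cst a b c : a <= b -> cint a b (fun=> c) = c * rc (b - a).
Proof.
move=> ab; apply/eqP; rewrite eq_complex /= !itg_cst//.
by case: c => u v /=; rewrite !mulr0 subr0 add0r; apply/andP; split.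
Qed.

End ComplexIntegral.

(** * Goursat's theorem for complex functions on a rectangle *)

Section ComplexGoursat.
Variable R : realType.
Notation C := (Cplx R).
Implicit Types (F G : R * R -> C) (p q : R * R).

(* Caratheodory's form of differentiability at p with partial derivatives a, b:
   continuity of the slopes A, B at p replaces all remainder estimates. *)
Definition slopes F p (a b : C) := exists A B : R * R -> C,
  [/\ {for p, continuous A}, {for p, continuous B}, A p = a, B p = b &
      forall q, F q - F p = rc (q.1 - p.1) * A q + rc (q.2 - p.2) * B q].

Lemma continuous_rcB (T : topologicalType) (h : T -> R) x (y : R) :
  {for x, continuous h} -> {for x, continuous (fun v => rc (h v - y))}.
Proof.
move=> ch; apply: (@continuous_comp _ _ _ (fun v => h v - y) (@rc R)).
  by apply: cvgB ch (cvg_cst _).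
exact: continuous_rc.
Qed.

Lemma continuous_forD (T : topologicalType) (f g : T -> C) x :
  {for x, continuous f} -> {for x, continuous g} ->
  {for x, continuous (fun v => f v + g v)}.
Proof. by move=> cf cg; exact: (cvgD cf cg). Qed.

Lemma continuous_forM (T : topologicalType) (f g : T -> C) x :
  {for x, continuous f} -> {for x, continuous g} ->
  {for x, continuous (fun v => f v * g v)}.
Proof. by move=> cf cg; exact: (cvgM cf cg). Qed.

Lemma continuous_for_cst (T : topologicalType) (k : C) (x : T) :
  {for x, continuous (fun=> k)}.
Proof. exact: cvg_cst. Qed.

Lemma continuous_mul (T : topologicalType) (f g : T -> C) :
  continuous f -> continuous g -> continuous (fun v => f v * g v).
Proof. by move=> cf cg x; apply: continuous_forM; [exact: cf | exact: cg]. Qed.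

Lemma continuous_sub (T : topologicalType) (f g : T -> C) :
  continuous f -> continuous g -> continuous (fun v => f v - g v).
Proof. by move=> cf cg x; apply: cvgB; [exact: cf | exact: cg]. Qed.

Lemma continuous_cst_mul (T : topologicalType) (k : C) (f : T -> C) :
  continuous f -> continuous (fun v => k * f v).
Proof. by move=> cf x; apply: cvgM; [exact: cvg_cst | exact: cf]. Qed.

Lemma continuous_cst_add (T : topologicalType) (k : C) (f : T -> C) :
  continuous f -> continuous (fun v => k + f v).
Proof. by move=> cf x; apply: cvgD; [exact: cvg_cst | exact: cf]. Qed.

Lemma continuous_sub_cst (T : topologicalType) (k : C) (f : T -> C) :
  continuous f -> continuous (fun v => f v - k).
Proof. by move=> cf x; apply: cvgB; [exact: cf | exact: cvg_cst]. Qed.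

Lemma continuous_fst p : {for p, continuous (fst : R * R -> R)}.
Proof. exact: cvg_fst. Qed.

Lemma continuous_snd p : {for p, continuous (snd : R * R -> R)}.
Proof. exact: cvg_snd. Qed.

Lemma slopes_continuous F p a b : slopes F p a b -> {for p, continuous F}.
Proof.
move=> [A [B [cA cB _ _ FE]]].
have -> : F = fun q => F p + (rc (q.1 - p.1) * A q + rc (q.2 - p.2) * B q).
  by apply/funext => q; rewrite -FE addrC subrK.
apply: continuous_forD; first exact: continuous_for_cst.
have c1 : {for p, continuous (fun q : R * R => rc (q.1 - p.1))}.
  by apply: continuous_rcB; exact: continuous_fst.
have c2 : {for p, continuous (fun q : R * R => rc (q.2 - p.2))}.
  by apply: continuous_rcB; exact: continuous_snd.
exact: continuous_forD (continuous_forM c1 cA) (continuous_forM c2 cB).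
Qed.

Lemma slopesM F G p a b c d : slopes F p a b -> slopes G p c d ->
  slopes (fun q => F q * G q) p (a * G p + F p * c) (b * G p + F p * d).
Proof.
move=> sF sG; have cG := slopes_continuous sG.
move: sF sG => [A [B [cA cB <- <- FE]]] [A' [B' [cA' cB' <- <- GE]]].
exists (fun q => A q * G q + F p * A' q), (fun q => B q * G q + F p * B' q).
have cK : {for p, continuous (fun _ : R * R => F p)} by exact: continuous_for_cst.
split.
- exact: (continuous_forD (continuous_forM cA cG) (continuous_forM cK cA')).
- exact: (continuous_forD (continuous_forM cB cG) (continuous_forM cK cB')).
- by [].
- by [].
- move=> q; have -> : F q * G q - F p * G p = (F q - F p) * G q + F p * (G q - G p).
    by ring.
  by rewrite FE GE; ring.
Qed.

Lemma slopes_comp (f : C -> C) F p a b : derivable f (F p) 1 -> slopes F p a b ->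
  slopes (fun q => f (F q)) p ('D_1 f (F p) * a) ('D_1 f (F p) * b).
Proof.
move=> /derivable_slope[phi [cphi <- fE]] sF.
have cF := slopes_continuous sF; move: sF => [A [B [cA cB <- <- FE]]].
exists (fun q => phi (F q) * A q), (fun q => phi (F q) * B q); split; [ | |by []|by []| ].
- apply: continuous_forM cA; exact: (continuous_comp cF cphi).
- apply: continuous_forM cB; exact: (continuous_comp cF cphi).
- by move=> q; rewrite fE FE; ring.
Qed.

Lemma slopes_fst p : slopes (fun q => rc q.1) p 1 0.
Proof.
exists (fun=> 1), (fun=> 0); split; [exact: continuous_for_cst|exact: continuous_for_cst|by []|by []|].
by move=> q; rewrite mulr0 addr0 mulr1 rcB.
Qed.

(** The derivative of [g] is given by a slope function, which avoids viewing C as a normed space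
    over R. *)
Lemma slopes_snd (g : R -> C) p (d : C) :
  (exists phi : R -> C, [/\ {for p.2, continuous phi}, phi p.2 = d &
    forall y, g y - g p.2 = rc (y - p.2) * phi y]) ->
  slopes (fun q => g q.2) p 0 d.
Proof.
move=> [phi [cphi <- gE]]; exists (fun=> 0), (fun q => phi q.2); split; [ | |by []|by []| ].
- exact: continuous_for_cst.
- exact: (continuous_comp (continuous_snd (p := p)) cphi).
- by move=> q; rewrite mulr0 add0r gE.
Qed.

Lemma slopes_addl F p a b (k : C) : slopes F p a b ->
  slopes (fun q => k + F q) p a b.
Proof.
move=> [A [B [cA cB <- <- FE]]]; exists A, B; split=> // q.
by rewrite -FE; ring.
Qed.

(** [L] is to be the real or the imaginary part; real linearity lets it pass through the slope
    identity. *)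
Lemma slopes_near_affine (L : C -> R) F p a b e :
  continuous L -> (forall z w, L (z + w) = L z + L w) ->
  (forall x z, L (rc x * z) = x * L z) ->
  slopes F p a b -> 0 < e ->
  \forall q \near p, near_affine (L \o F) p (L a) (L b) e q.
Proof.
move=> cL LD LM [A [B [cA cB <- <- FE]]] e0.
have LB z w : L (z - w) = L z - L w.
  by apply/eqP; rewrite eq_sym subr_eq -LD subrK.
have nearL (A' : R * R -> C) : {for p, continuous A'} ->
    \forall q \near p, `|L (A' p) - L (A' q)| <= e.
  move=> cA'; have := @continuous_comp _ _ _ A' L p cA' (cL _).
  by move=> /(@cvgrPdist_le R R _ (nbhs p)); apply.
near=> q.
have hA : `|L (A p) - L (A q)| <= e by near: q; exact: nearL.
have hB : `|L (B p) - L (B q)| <= e by near: q; exact: nearL.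
rewrite /near_affine /= -LB FE LD !LM.
have -> : (q.1 - p.1) * L (A q) + (q.2 - p.2) * L (B q) - L (A p) * (q.1 - p.1)
   - L (B p) * (q.2 - p.2) = - ((q.1 - p.1) * (L (A p) - L (A q)) +
      (q.2 - p.2) * (L (B p) - L (B q))) by ring.
have -> : e * (`|q.1 - p.1| + `|q.2 - p.2|) = `|q.1 - p.1| * e + `|q.2 - p.2| * e by ring.
rewrite normrN; apply: le_trans (ler_normD _ _) _.
by rewrite !normrM; apply: lerD; apply: ler_wpM2l.
Unshelve. all: by end_near. Qed.

Lemma Re_add (z w : C) : complex.Re (z + w) = complex.Re z + complex.Re w.
Proof. by case: z; case: w. Qed.
Lemma Im_add (z w : C) : complex.Im (z + w) = complex.Im z + complex.Im w.
Proof. by case: z; case: w. Qed.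

(** Closedness is the coefficient [b] common to [P] and [Q]. Since [P] agrees on the bottom and top
    sides, their integrals cancel, and the vanishing loop integral says that the two vertical
    integrals are equal. *)
Lemma goursat (P Q : R * R -> C) (x0 y0 al be : R) : 0 <= al -> 0 <= be ->
  (forall p, in_rect x0 y0 al be p ->
     exists a b c, slopes P p a b /\ slopes Q p b c) ->
  (forall s, P (s, y0 + be) = P (s, y0)) ->
  cint y0 (y0 + be) (fun t => Q (x0 + al, t)) =
  cint y0 (y0 + be) (fun t => Q (x0, t)).
Proof.
move=> al0 be0 PQ per.
have main (L : C -> R) : continuous L -> (forall z w, L (z + w) = L z + L w) ->
    (forall x z, L (rc x * z) = x * L z) ->
    itg y0 (y0 + be) (fun t => L (Q (x0 + al, t))) =
    itg y0 (y0 + be) (fun t => L (Q (x0, t))).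
  move=> cL LD LM; apply/eqP; rewrite -subr_eq0; apply/eqP.
  have := @loop_itg_closed R (L \o P) (L \o Q) x0 y0 al be al0 be0.
  rewrite /loop_itg !mulr1 /=.
  have -> : (fun s => L (P (s, y0 + be))) = (fun s => L (P (s, y0))).
    by apply/funext => s; rewrite per.
  have -> (i j k : R) : i + j - i - k = j - k by ring.
  apply.
    move=> p /PQ[a [b [c [sP sQ]]]].
    by split; apply: (@continuous_comp _ _ _ _ L); [exact: slopes_continuous sP |
      exact: cL | exact: slopes_continuous sQ | exact: cL].
  move=> p /PQ[a [b [c [sP sQ]]]]; exists (L a), (L b), (L c) => e e0.
  near=> q; split; near: q.
    exact: slopes_near_affine sP e0.
  exact: slopes_near_affine sQ e0.
apply/eqP; rewrite eq_complex /=; apply/andP; split; apply/eqP; apply: main.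
- exact: continuous_Re.
- exact: Re_add.
- exact: Re_rcM.
- exact: continuous_Im.
- exact: Im_add.
- exact: Im_rcM.
Unshelve. all: by end_near. Qed.

Definition ci : C := Complex 0 1.

Lemma sqr_ci : ci * ci = -1.
Proof. by apply/eqP; rewrite eq_complex /= !(mul0r, mulr0, mulr1, mul1r, sub0r, addr0, oppr0, eqxx). Qed.

(** The point r e^(it). *)
Definition circle (r t : R) : C := rc r * (rc (cos t) + ci * rc (sin t)).

Lemma norm_circle (r t : R) : 0 <= r -> `|circle r t| = rc r.
Proof.
move=> r0; rewrite /circle normrM rc_norm (ger0_norm r0) normc_def /=.
rewrite !(mul0r, mul1r, mulr0, addr0, add0r, subr0) cos2Dsin2 sqrtr1.
by rewrite -[real_complex _ _]/(1 : C) mulr1.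
Qed.

Lemma circle_periodic (r : R) : circle r (pi *+ 2) = circle r 0.
Proof. by rewrite /circle cos2pi sin2pi cos0 sin0. Qed.

Lemma circle_slope (r t : R) : exists phi : R -> C,
  [/\ {for t, continuous phi}, phi t = ci * circle r t &
    forall s, circle r s - circle r t = rc (s - t) * phi s].
Proof.
have /derivable_slope[pc [cpc pcE cE]] : derivable (@cos R) t 1 by [].
have /derivable_slope[ps [cps psE sE]] : derivable (@sin R) t 1 by [].
have cr (h : R -> R) : {for t, continuous h} -> {for t, continuous (fun s => rc (h s))}.
  by move=> ch; apply: (continuous_comp ch); exact: continuous_rc.
exists (fun s => rc r * (rc (pc s) + ci * rc (ps s))); split.
- apply: continuous_forM; first exact: continuous_for_cst.
  apply: continuous_forD; first exact: cr.
  by apply: continuous_forM; [exact: continuous_for_cst | exact: cr].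
- rewrite pcE psE !derive_val /circle.
  rewrite (_ : rc (- sin t) = ci * ci * rc (sin t)); first by ring.
  by rewrite sqr_ci mulN1r -[in LHS]sub0r rcB sub0r.
- move=> s; rewrite /circle.
  rewrite (_ : _ - _ = rc r * (rc (cos s - cos t) + ci * rc (sin s - sin t))).
    by rewrite cE sE !rcM; ring.
  by rewrite !rcB; ring.
Qed.

Lemma continuous_circle (r : R) : continuous (circle r).
Proof.
move=> t; have [phi [cphi _ E]] := circle_slope r t.
have -> : circle r = fun s => circle r t + rc (s - t) * phi s.
  by apply/funext => s; rewrite -E addrC subrK.
have ct : {for t, continuous (fun s => rc (s - t))}.
  by apply: continuous_rcB; exact: cvg_id.
have cK : {for t, continuous (fun _ : R => circle r t)} by exact: continuous_for_cst.
exact: (continuous_forD cK (continuous_forM ct cphi)).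
Qed.

End ComplexGoursat.

(** * Cauchy's integral formula *)

Section CauchyFormula.
Variable R : realType.
Notation C := (Cplx R).
Notation tau := (pi *+ 2 : R).

Lemma derivable_continuous (f : C -> C) z : derivable f z 1 -> {for z, continuous f}.
Proof. by move=> /derivable1_diffP /differentiable_continuous. Qed.

Lemma continuous_seg_bounded (a b : R) (g : R -> C) : a <= b -> continuous g ->
  exists M : C, 0 <= M /\ forall x, a <= x <= b -> `|g x| <= M.
Proof.
move=> ab cg; pose h x := `|complex.Re (g x)| + `|complex.Im (g x)|.
have ch : {within `[a, b], continuous h}.
  apply: continuous_subspaceT => x; apply: cvgD.
    apply: (@continuous_comp _ _ _ (fun x => complex.Re (g x)) Num.norm).
      exact/continuous_ReF/cg.
    exact: norm_continuous.
  apply: (@continuous_comp _ _ _ (fun x => complex.Im (g x)) Num.norm).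
    exact/continuous_ImF/cg.
  exact: norm_continuous.
have [c _ cM] := EVT_max ab ch.
exists (rc (h c)); split; first by rewrite (ler_rc 0) addr_ge0.
move=> x xab; apply: (@le_trans _ _ (rc (h x))); last first.
  by rewrite ler_rc cM// in_itv.
rewrite {1}(complexE (g x)) /h rcD; apply: le_trans (ler_normD _ _) _.
rewrite normrM -[real_complex _ _]/(rc _) -[X in _ * `|X|]/(rc _) !rc_norm.
have -> : `|('i)%C| = 1 :> C.
  by rewrite normc_def /= expr0n /= add0r expr1n sqrtr1.
by rewrite mul1r.
Qed.

Lemma normr_small0 (K : numFieldType) (x M : K) : 0 <= M ->
  (forall e, 0 < e -> `|x| <= M * e) -> x = 0.
Proof.
move=> M0 xM; apply/eqP/negPn/negP => x0.
have M1 : 0 < M + 1 by rewrite ltr_wpDl.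
have := xM (`|x| / (M + 1)); rewrite divr_gt0 ?normr_gt0// => /(_ isT).
rewrite mulrCA ler_pMr ?normr_gt0// ler_pdivlMr// mul1r.
by rewrite gerDl ler10.
Qed.

(** * Differentiation of Cauchy integrals with respect to the pole *)

Section Kernel.
Variables (a b : R) (c phi : R -> C) (w d : C).
Hypotheses (ab : a <= b) (cc : continuous c) (cphi : continuous phi).
Hypotheses (d0 : 0 < d) (wd : forall t, d <= `|c t - w|).

Lemma kernel_far (h : C) : `|h| <= d / 2 -> forall t, d / 2 <= `|c t - (w + h)|.
Proof.
move=> hd t; rewrite opprD addrA; apply: le_trans (lerB_dist _ _).
by apply: le_trans (lerB (wd t) hd); rewrite {2}(splitr d) addrK.
Qed.

Lemma continuous_kernel (v : C) k : (forall t, c t != v) ->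
  continuous (fun t => phi t / (c t - v) ^+ k).
Proof.
move=> cv t; apply: (@continuous_forM R _ phi (fun t => ((c t - v) ^+ k)^-1)).
  exact: cphi.
have cB : {for t, continuous (fun t => (c t - v) ^+ k)}.
  apply: (@continuous_comp _ _ _ (fun t => c t - v) (fun y => y ^+ k)).
    by have cB := @continuous_sub_cst R _ v _ cc; exact: cB.
  exact/derivable_continuous/exprn_derivable.
apply: (continuous_comp cB); apply: inv_continuous.
by rewrite expf_neq0// subr_eq0.
Qed.

Lemma kernel_far_neq (h : C) : `|h| <= d / 2 -> forall t, c t != w + h.
Proof.
move=> /kernel_far hd t; rewrite -subr_eq0 -normr_gt0.
by apply: lt_le_trans (hd t); rewrite divr_gt0.
Qed.

Lemma is_derive_kernel_of k (S : R -> C) (M : C) : 0 <= M -> continuous S ->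
  (forall h t, `|h| <= d / 2 -> a <= t <= b ->
    `|phi t / (c t - (w + h)) ^+ k - phi t / (c t - w) ^+ k - h * S t|
      <= M * `|h| ^+ 2) ->
  is_derive w 1 (fun v => cint a b (fun t => phi t / (c t - v) ^+ k)) (cint a b S).
Proof.
move=> M0 cS hM; apply: (@quadratic_is_derive _ _ _ _ (2 * rc (b - a) * M)).
  by rewrite !mulr_ge0// (ler_rc 0) subr_ge0.
have d20 : 0 < d / 2 by rewrite divr_gt0.
near=> h; have hd : `|h| <= d / 2.
  by near: h; exact: (@nbhs0_le C C _ d20).
have c1 := continuous_kernel (k := k) (kernel_far_neq hd).
have c2 : continuous (fun t => phi t / (c t - w) ^+ k).
  by apply: continuous_kernel => t; rewrite -subr_eq0 -normr_gt0 (lt_le_trans d0).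
have chS : continuous (fun t => h * S t) := @continuous_cst_mul R _ h _ cS.
have c12 : continuous (fun t => phi t / (c t - (w + h)) ^+ k - phi t / (c t - w) ^+ k).
  exact: (@continuous_sub R _ _ _ c1 c2).
rewrite -(@cintZ R _ _ h _ cS) -(@cintB R _ _ _ _ c1 c2) -(@cintB R _ _ _ _ c12 chS).
rewrite -[leRHS]mulrA; apply: (cint_bound ab (@continuous_sub R _ _ _ c12 chS)).
by move=> t tab; apply: hM.
Unshelve. all: by end_near. Qed.

Lemma is_derive_kernel1 :
  is_derive w 1 (fun v => cint a b (fun t => phi t / (c t - v) ^+ 1))
    (cint a b (fun t => phi t / (c t - w) ^+ 2)).
Proof.
have [M [M0 phiM]] := continuous_seg_bounded ab cphi.
have d20 : 0 < d / 2 by rewrite divr_gt0.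
have cw t : c t != w by rewrite -subr_eq0 -normr_gt0 (lt_le_trans d0).
apply: (@is_derive_kernel_of 1 _ (M * ((d ^+ 2)^-1 * (d / 2)^-1))).
- by rewrite !mulr_ge0// invr_ge0 ?exprn_ge0// ltW.
- exact: (continuous_kernel (k := 2) cw).
- move=> h t hd tab; have vh := kernel_far hd t; have v0 := wd t.
  have n1 : c t - w != 0 by rewrite subr_eq0.
  have n2 : c t - (w + h) != 0 by rewrite subr_eq0 kernel_far_neq.
  (* With u = c t - w: 1/(u - h) - 1/u - h/u^2 = h^2 / (u^2 (u - h)). *)
  have -> : phi t / (c t - (w + h)) ^+ 1 - phi t / (c t - w) ^+ 1
      - h * (phi t / (c t - w) ^+ 2)
      = phi t * (((c t - w) ^+ 2)^-1 * (c t - (w + h))^-1) * h ^+ 2.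
    by field; rewrite n1 n2.
  rewrite normrM normrX ler_wpM2r ?exprn_ge0// normrM ler_pM//; first exact: phiM.
  rewrite normrM !normfV normrX ler_pM ?invr_ge0 ?exprn_ge0//.
    by rewrite lef_pV2 ?posrE ?exprn_gt0 ?normr_gt0// lerXn2r ?nnegrE// ltW.
  by rewrite lef_pV2 ?posrE ?normr_gt0.
Qed.

Lemma derivable_kernel2 :
  derivable (fun v => cint a b (fun t => phi t / (c t - v) ^+ 2)) w 1.
Proof.
have [M [M0 phiM]] := continuous_seg_bounded ab cphi.
have d20 : 0 < d / 2 by rewrite divr_gt0.
have cw t : c t != w by rewrite -subr_eq0 -normr_gt0 (lt_le_trans d0).
suff /@ex_derive : is_derive w 1 (fun v => cint a b (fun t => phi t / (c t - v) ^+ 2))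
    (cint a b (fun t => 2 * (phi t / (c t - w) ^+ 3))) by [].
(* This bounds the bracket of the exact remainder computed below, where u = c t - w has norm at
   least [d] and u - h at least [d / 2]. *)
pose B := (d ^+ 2)^-1 * ((d / 2) ^+ 2)^-1 + 2 * ((d ^+ 3)^-1 * (d / 2)^-1).
apply: (@is_derive_kernel_of 2 _ (M * B)).
- by rewrite mulr_ge0// addr_ge0// !mulr_ge0// invr_ge0 ?exprn_ge0// ltW.
- exact: (@continuous_cst_mul R _ 2 _ (continuous_kernel (k := 3) cw)).
- move=> h t hd tab; have vh := kernel_far hd t; have v0 := wd t.
  have n1 : c t - w != 0 by rewrite subr_eq0.
  have n2 : c t - (w + h) != 0 by rewrite subr_eq0 kernel_far_neq.
  have -> : phi t / (c t - (w + h)) ^+ 2 - phi t / (c t - w) ^+ 2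
      - h * (2 * (phi t / (c t - w) ^+ 3))
      = phi t * (((c t - w) ^+ 2)^-1 * ((c t - (w + h)) ^+ 2)^-1 +
          2 * (((c t - w) ^+ 3)^-1 * (c t - (w + h))^-1)) * h ^+ 2.
    by field; rewrite n1 n2.
  have inv_far k : (`|c t - w| ^+ k)^-1 <= (d ^+ k)^-1.
    by rewrite lef_pV2 ?posrE ?exprn_gt0 ?normr_gt0// lerXn2r ?nnegrE// ltW.
  have inv_farh k : (`|c t - (w + h)| ^+ k)^-1 <= ((d / 2) ^+ k)^-1.
    by rewrite lef_pV2 ?posrE ?exprn_gt0 ?normr_gt0// lerXn2r ?nnegrE// ltW.
  have inv_ge0 (x : C) k : 0 <= (`|x| ^+ k)^-1 by rewrite invr_ge0 exprn_ge0.
  rewrite normrM normrX ler_wpM2r ?exprn_ge0// normrM ler_pM//; first exact: phiM.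
  apply: le_trans (ler_normD _ _) _; apply: lerD.
    by rewrite normrM !normfV !normrX ler_pM.
  rewrite normrM ger0_norm// ler_wpM2l// normrM !normfV normrX ler_pM ?invr_ge0 ?exprn_ge0//.
  by have := inv_farh 1%N; rewrite !expr1.
Qed.

End Kernel.

(* Shrinking the circle c t linearly to w, Goursat's theorem is applied to the
   closed form h(psi) dpsi on the rectangle [s, 1] x [0, 2 pi]; then s -> 0. The
   winding integral on the left is not evaluated, as derivable_derive1 only needs
   that it is nonzero at the centre. *)
Lemma cauchy_formula (f : C -> C) (z0 w : C) (r : R) : 0 < r ->
  (forall v, `|v - z0| <= rc r -> derivable f v 1) -> `|w - z0| < rc r ->
  f w * cint 0 tau (fun t => ci R * circle r t / (z0 + circle r t - w) ^+ 1) =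
  cint 0 tau (fun t => f (z0 + circle r t) * (ci R * circle r t) /
                        (z0 + circle r t - w) ^+ 1).
Proof.
move=> r0 df wr; set c := fun t => z0 + circle r t.
have tau0 : 0 <= tau by rewrite mulrn_wge0// pi_ge0.
have rc0 : 0 < rc r by rewrite (ltr_rc 0).
pose d := rc r - `|w - z0|; have d0 : 0 < d by rewrite subr_gt0.
have cd t : d <= `|c t - w|.
  rewrite /d -(norm_circle t (ltW r0)) (_ : c t - w = circle r t - (w - z0)).
    exact: lerB_dist.
  by rewrite /c; ring.
have cw t : c t - w != 0 by rewrite -normr_gt0 (lt_le_trans d0).
have cc : continuous c.
  exact: (@continuous_cst_add R _ z0 _ (@continuous_circle R r)).
pose psi (s t : R) : C := w + rc s * (c t - w).
have psiw s t : psi s t - w = rc s * (c t - w) by rewrite /psi (addrC w) addrK.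
have psi_in s t : 0 <= s <= 1 -> `|psi s t - z0| <= rc r.
  move=> /andP[s0 s1].
  have -> : psi s t - z0 = rc (1 - s) * (w - z0) + rc s * circle r t.
    by rewrite rcB -[rc 1]/(1 : C) /psi /c; ring.
  apply: le_trans (ler_normD _ _) _; rewrite normrM (normrM (rc s)).
  rewrite (norm_circle t (ltW r0)) !rc_norm (ger0_norm s0).
  have s1' : 0 <= 1 - s by rewrite subr_ge0.
  rewrite (ger0_norm s1').
  have {2}-> : rc r = rc (1 - s) * rc r + rc s * rc r by rewrite rcB -[rc 1]/(1 : C); ring.
  by rewrite lerD2r ler_wpM2l ?(ler_rc 0)// ltW.
pose k t := ci R * circle r t / (c t - w) ^+ 1.
have ccu : continuous (fun t => ci R * circle r t).
  exact: (@continuous_cst_mul R _ (ci R) _ (@continuous_circle R r)).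
have ck : continuous k.
  by apply: (continuous_kernel cc ccu) => t; rewrite -subr_eq0; exact: cw.
have cf s : 0 <= s <= 1 -> continuous (fun t => f (psi s t)).
  move=> s01 t; apply: (@continuous_comp _ _ _ (psi s) f).
    exact: (@continuous_cst_add R _ w _ (@continuous_cst_mul R _ (rc s) _ (@continuous_sub_cst R _ w _ cc))).
  exact/derivable_continuous/df/psi_in.
pose J s := cint 0 tau (fun t => f (psi s t) * k t).
have shrink s : 0 < s <= 1 -> J 1 = J s.
  move=> /andP[s0 s1].
  pose h v := f v / (v - w).
  (* The last factors of [P] and [Q] are the partial derivatives of [psi] in s and t. *)
  pose P q := h (psi q.1 q.2) * (c q.2 - w).
  pose Q q := h (psi q.1 q.2) * (rc q.1 * (ci R * circle r q.2)).
  (* The factor [rc v] cancels against psi - w = rc v (c t - w), so the integral of [Q] on the line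
     s = v is [J v]. *)
  have QE v : 0 < v -> (fun t => Q (v, t)) = fun t => f (psi v t) * k t.
    move=> v0; apply/funext => t; rewrite /Q /h /k psiw expr1 /=.
    have v0' : rc v != 0 by rewrite gt_eqF ?(ltr_rc 0).
    move: (rc v) (c t - w) (cw t) v0' (f _) (ci R * _) => x y y0 x0 u1 u2.
    by field; rewrite x0 y0.
  have := @goursat R P Q s 0 (1 - s) tau.
  rewrite subr_ge0 add0r subrKC !QE// /J; apply=> //.
    move=> p [/andP[p1 p2] _]; rewrite subrKC in p2.
    have p0 : 0 < p.1 by exact: lt_le_trans p1.
    have sg : slopes (fun q : R * R => c q.2 - w) p 0 (ci R * circle r p.2).
      apply: (@slopes_snd R (fun t => c t - w)).
      have [phi [cphi phiE E]] := circle_slope r p.2.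
      by exists phi; split=> // y; rewrite -E /c; ring.
    have spsi : slopes (fun q => psi q.1 q.2) p
        (1 * (c p.2 - w) + rc p.1 * 0) (0 * (c p.2 - w) + rc p.1 * (ci R * circle r p.2)).
      by apply: slopes_addl; apply: slopesM sg; exact: slopes_fst.
    have dh : derivable h (psi p.1 p.2) 1.
      apply: derivableM; first by apply/df/psi_in; rewrite ltW.
      apply: derivableV; last by apply: derivableB.
      by rewrite psiw mulf_neq0 ?cw// gt_eqF ?(ltr_rc 0).
    have sh := slopes_comp dh spsi.
    have su : slopes (fun q : R * R => ci R * circle r q.2) p 0 (ci R * (ci R * circle r p.2)).
      apply: (@slopes_snd R (fun t => ci R * circle r t)).
      have [phi [cphi phiE E]] := circle_slope r p.2.
      exists (fun t => ci R * phi t); split.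
      - by apply: continuous_forM cphi; exact: continuous_for_cst.
      - by rewrite phiE.
      - by move=> y; rewrite -mulrBr E; ring.
    have sP := slopesM sh sg.
    have sQ := slopesM sh (slopesM (slopes_fst p) su).
    do 3 eexists; split; first exact: sP.
    (* Both mixed coefficients are h'(psi) psi_s psi_t + h(psi) psi_st. *)
    by move: sQ; congr (slopes _ _ _ _); ring.
  by move=> v; rewrite /P /psi /c circle_periodic.
have J1 : J 1 = cint 0 tau (fun t => f (c t) * (ci R * circle r t) / (c t - w) ^+ 1).
  apply: eq_cint => t; rewrite /k /psi -[rc 1]/(1 : C) mul1r subrKC.
  by rewrite mulrA.
rewrite -J1; apply/esym/eqP; rewrite -subr_eq0; apply/eqP.
have [M [M0 kM]] := continuous_seg_bounded tau0 ck.
apply: (@normr_small0 _ _ (2 * rc (tau - 0) * M)).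
  by rewrite !mulr_ge0// (ler_rc 0) subr0.
move=> e e0.
have /derivable_continuous : derivable f w 1 by apply: df; exact: ltW.
move=> /(@cvgrPdist_le C C C (nbhs w)) /(_ _ e0) [_ /= /pos_rc[de de0 ->] dP].
(* The distance from the circle to [w] is at most 2 r, so the contracted curve stays within s 2 r <
   de of [w]; also 0 < s <= 1. *)
pose s := de / (2 * r + de).
have D0 : 0 < 2 * r + de by lra.
have s01 : 0 < s <= 1 by rewrite /s divr_gt0//= ler_pdivrMr// mul1r; lra.
have s01' : 0 <= s <= 1 by case/andP: s01 => /ltW -> ->.
have cfk := @continuous_mul R _ _ _ (cf s s01') ck.
have cfw := @continuous_cst_mul R _ (f w) _ ck.
rewrite (shrink s s01) /J -(@cintZ R _ _ (f w) _ ck) -(@cintB R _ _ _ _ cfk cfw).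
rewrite -[leRHS]mulrA; apply: (cint_bound tau0 (@continuous_sub R _ _ _ cfk cfw)).
move=> t tt; rewrite -mulrBl normrM mulrC ler_pM//; first exact: kM.
rewrite distrC; apply: dP; rewrite /= /psi opprD addNKr normrN normrM rc_norm.
have s0 : 0 < s by case/andP: s01.
rewrite (gtr0_norm s0).
apply: (@le_lt_trans _ _ (rc s * rc (2 * r))).
  apply: ler_wpM2l; first by rewrite (ler_rc 0) ltW.
  have -> : c t - w = circle r t - (w - z0) by rewrite /c; ring.
  apply: le_trans (ler_normB _ _) _; rewrite (norm_circle t (ltW r0)).
  by rewrite mulrDl mul1r rcD lerD2l ltW.
rewrite -rcM ltr_rc /s mulrAC ltr_pdivrMr// ltr_pM2l//; lra.
Qed.

(** Cauchy's formula reads f N = J, where N and J are integrals that can be differentiated twice in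
    the pole. Hence f' = (J' - f N') / N near z0, and each term on the right is derivable. The term
    with N' stays because N is computed at the centre only. *)
Lemma derivable_derive1 (f : C -> C) (z0 : C) (r : R) : 0 < r ->
  (forall v, `|v - z0| <= rc r -> derivable f v 1) -> derivable (derive1 f) z0 1.
Proof.
move=> r0 df; pose c t := z0 + circle r t.
have tau0 : 0 <= tau by rewrite mulrn_wge0// pi_ge0.
have rc0 : 0 < rc r by rewrite (ltr_rc 0).
have cc : continuous c.
  exact: (@continuous_cst_add R _ z0 _ (@continuous_circle R r)).
pose phN t := ci R * circle r t; pose phJ t := f (c t) * (ci R * circle r t).
have cN : continuous phN.
  exact: (@continuous_cst_mul R _ (ci R) _ (@continuous_circle R r)).
have cJ : continuous phJ.
  apply: continuous_mul cN => t; apply: (continuous_comp (cc t)).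
  apply/derivable_continuous/df; rewrite /c addrC addKr norm_circle//; exact: ltW.
pose I (ph : R -> C) k v := cint 0 tau (fun t => ph t / (c t - v) ^+ k).
have far v : `|v - z0| < rc r -> exists2 d : C, 0 < d & forall t, d <= `|c t - v|.
  move=> vr; exists (rc r - `|v - z0|); first by rewrite subr_gt0.
  move=> t; rewrite -(norm_circle t (ltW r0)).
  rewrite (_ : c t - v = circle r t - (v - z0)); first exact: lerB_dist.
  by rewrite /c; ring.
have dI ph v : continuous ph -> `|v - z0| < rc r -> is_derive v 1 (I ph 1%N) (I ph 2%N v).
  move=> cph /far[d d0 vd].
  exact: (is_derive_kernel1 tau0 cc cph d0 vd).
have dI2 ph v : continuous ph -> `|v - z0| < rc r -> derivable (I ph 2%N) v 1.
  move=> cph /far[d d0 vd].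
  exact: (derivable_kernel2 tau0 cc cph d0 vd).
have z0r : `|z0 - z0| < rc r by rewrite subrr normr0.
have N0 : I phN 1%N z0 != 0.
  (* At the centre the integrand is the constant i, so the integral is 2 pi i. *)
  have -> : I phN 1%N z0 = cint 0 tau (fun=> ci R).
    apply: eq_cint => t; rewrite /phN /c expr1 addrC addKr mulfK//.
    by rewrite -normr_gt0 norm_circle// ltW.
  rewrite cint_cst// mulf_neq0//.
    by apply/eqP => -[/eqP]; rewrite oner_eq0.
  by rewrite subr0 gt_eqF// (ltr_rc 0) mulrn_wgt0// pi_gt0.
have nearN : \forall v \near z0, I phN 1%N v != 0.
  have /derivable_continuous cI : derivable (I phN 1%N) z0 1.
    by have /@ex_derive := dI phN z0 cN z0r.
  have N0' : 0 < `|I phN 1%N z0| by rewrite normr_gt0.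
  move/(@cvgrPdist_lt C C C (nbhs z0)) : cI => /(_ _ N0').
  apply: filterS => v; apply: contraTneq => ->.
  by rewrite subr0 ltxx.
have nearD : \forall v \near z0, `|v - z0| < rc r.
  by exists (rc r) => //= v; rewrite /ball_ /= distrC.
have fE v : `|v - z0| < rc r -> f v * I phN 1%N v = I phJ 1%N v.
  exact: cauchy_formula.
pose f' v := (I phJ 2%N v - f v * I phN 2%N v) / I phN 1%N v.
have f'E : \forall v \near z0, f' v = derive1 f v.
  near=> v; have vr : `|v - z0| < rc r by near: v.
  have Nv : I phN 1%N v != 0 by near: v.
  have dfv : derivable f v 1 by apply: df; exact: ltW.
  have : 'D_1 (fun v => f v * I phN 1%N v) v = 'D_1 (I phJ 1%N) v.
    apply: near_eq_derive; near=> u; apply: fE; near: u.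
    exists (rc r - `|v - z0|) => /=; first by rewrite subr_gt0.
    move=> u /=; rewrite distrC ltrBrDr => uv.
    by apply: le_lt_trans uv; rewrite -[in leLHS](subrK v u) -addrA ler_normD.
  have iN := dI phN v cN vr; have iJ := dI phJ v cJ vr.
  rewrite (deriveM dfv (@ex_derive _ _ _ _ _ _ _ iN)) !derive_val.
  rewrite -![_ *: _]/(_ * _) /f' derive1E => <-; field.
  exact: Nv.
apply: near_eq_derivable f'E _.
apply: derivableM.
  apply: derivableB; first exact: dI2.
  apply: derivableM; last exact: dI2.
  by apply: df; exact: ltW.
apply: derivableV => //.
by have /@ex_derive := dI phN z0 cN z0r.
Unshelve. all: by end_near. Qed.

End CauchyFormula.

(** * Holomorphic functions on the disc *)

(** The induction step of the Leibniz rule, with [a k] and [b k] standing for k-th derivatives. *)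
Lemma pascal_convolution (K : pzRingType) m (a b : nat -> K) :
  \sum_(k < m.+1) 'C(m, k)%:R * (a (m.+1 - k)%N * b k)
  + \sum_(k < m.+1) 'C(m, k)%:R * (a (m - k)%N * b k.+1)
  = \sum_(k < m.+2) 'C(m.+1, k)%:R * (a (m.+1 - k)%N * b k).
Proof.
have -> : \sum_(k < m.+1) 'C(m, k)%:R * (a (m.+1 - k)%N * b k)
    = \sum_(k < m.+2) 'C(m, k)%:R * (a (m.+1 - k)%N * b k).
  by rewrite [RHS]big_ord_recr /= bin_small// mul0r addr0.
rewrite !(big_ord_recl m.+1) /= !bin0 -addrA -big_split /=; congr (_ + _).
apply: eq_bigr => i _; rewrite /bump /= add1n subSS binS natrD mulrDl.
by rewrite addrC addrC.
Qed.

Section HolomorphicCalculus.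
Variable R : realType.
Notation C := (Cplx R).
Notation D := (unit_disc R).
Implicit Types (h l F G : C -> C) (z w : C).

Lemma near_unit_disc z : D z -> \forall w \near z, D w.
Proof.
move=> zD; exists (1 - `|z|) => /=; first by rewrite subr_gt0.
move=> w /=; rewrite distrC ltrBrDr => wz; rewrite /unit_disc /=.
by apply: le_lt_trans wz; rewrite -[in leLHS](subrK z w) ler_normD.
Qed.

Lemma eq_derive1_disc (W : normedModType C) (F G : C -> W) :
  (forall z, D z -> F z = G z) -> forall z, D z -> derive1 F z = derive1 G z.
Proof.
move=> FG z zD; rewrite !derive1E; apply: near_eq_derive.
by near=> w; apply: FG; near: w; exact: near_unit_disc.
Unshelve. all: by end_near. Qed.

Lemma eq_holomorphic_disc (W : normedModType C) (F G : C -> W) :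
  (forall z, D z -> F z = G z) -> holomorphic F -> holomorphic G.
Proof.
move=> FG hF z zD; apply: near_eq_derivable (hF z zD).
by near=> w; apply: FG; near: w; exact: near_unit_disc.
Unshelve. all: by end_near. Qed.

Lemma holomorphic_derive1 h : holomorphic h -> holomorphic (derive1 h).
Proof.
move=> hh z zD; have z0 : 0 < 1 - `|z| by rewrite subr_gt0.
have [r r0 rE] := pos_rc z0.
(* Half the distance to the boundary, since a closed disc inside the open one is wanted. *)
apply: (@derivable_derive1 R h z (r / 2)); first by rewrite divr_gt0.
move=> v vz; apply: hh; rewrite /unit_disc /= -[v](subrK z).
apply: le_lt_trans (ler_normD _ _) _; apply: (@le_lt_trans _ _ (rc (r / 2) + `|z|)).
  by rewrite lerD2r.
rewrite -ltrBrDr rE ltr_rc; lra.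
Qed.

Lemma holomorphic_derive1n h k : holomorphic h -> holomorphic (derive1n k h).
Proof.
by move=> hh; elim: k => [|k IH]; [exact: hh | exact: (holomorphic_derive1 IH)].
Qed.

Lemma holomorphicM F G : holomorphic F -> holomorphic G ->
  holomorphic (fun z => F z * G z).
Proof. by move=> hF hG z zD; apply: derivableM; [exact: hF | exact: hG]. Qed.

Lemma holomorphic_cst (k : C) : holomorphic (fun=> k : C).
Proof. by move=> z zD; exact: derivable_cst. Qed.

Lemma holomorphic_sum (I : Type) (s : seq I) (F : I -> C -> C) :
  (forall i, holomorphic (F i)) -> holomorphic (fun z => \sum_(i <- s) F i z).
Proof.
move=> hF; elim: s => [|i s IH].
  rewrite (_ : (fun z => _) = fun=> 0); first exact: holomorphic_cst.
  by apply/funext => z; rewrite big_nil.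
rewrite (_ : (fun z => _) = fun z => F i z + \sum_(i <- s) F i z).
  by move=> z zD; apply: derivableD; [exact: hF | exact: IH].
by apply/funext => z; rewrite big_cons.
Qed.

Lemma holomorphic_prod (I : Type) (s : seq I) (F : I -> C -> C) :
  (forall i, holomorphic (F i)) -> holomorphic (fun z => \prod_(i <- s) F i z).
Proof.
move=> hF; elim: s => [|i s IH].
  rewrite (_ : (fun z => _) = fun=> 1); first exact: holomorphic_cst.
  by apply/funext => z; rewrite big_nil.
rewrite (_ : (fun z => _) = fun z => F i z * \prod_(i <- s) F i z).
  exact: (holomorphicM (hF i) IH).
by apply/funext => z; rewrite big_cons.
Qed.

Lemma holomorphic_det m (M : C -> 'M[C]_m) :
  (forall i j, holomorphic (fun z => M z i j)) -> holomorphic (fun z => \det (M z)).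
Proof.
move=> hM; rewrite /determinant; apply: holomorphic_sum => s.
apply: holomorphicM; first exact: holomorphic_cst.
by apply: holomorphic_prod => i.
Qed.

Lemma holomorphic_adj m (M : C -> 'M[C]_m) i j :
  (forall i j, holomorphic (fun z => M z i j)) -> holomorphic (fun z => (\adj (M z)) i j).
Proof.
move=> hM; rewrite (_ : (fun z => _) = fun z => cofactor (M z) j i); last first.
  by apply/funext => z; rewrite mxE.
rewrite /cofactor; apply: holomorphicM; first exact: holomorphic_cst.
apply: holomorphic_det => a b.
rewrite (_ : (fun z => _) = fun z => M z (lift j a) (lift i b)); first exact: hM.
by apply/funext => z; rewrite !mxE.
Qed.

Lemma derive1M F G z : holomorphic F -> holomorphic G -> D z ->
  derive1 (fun w => F w * G w) z = derive1 F z * G z + F z * derive1 G z.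
Proof.
move=> hF hG zD; rewrite !derive1E (deriveM (hF z zD) (hG z zD)).
by rewrite -![_ *: _]/(_ * _) addrC (mulrC (G z)).
Qed.

Lemma derive1_sum (I : Type) (s : seq I) (F : I -> C -> C) z :
  (forall i, holomorphic (F i)) -> D z ->
  derive1 (fun w => \sum_(i <- s) F i w) z = \sum_(i <- s) derive1 (F i) z.
Proof.
move=> hF zD; elim: s => [|i s IH].
  rewrite (_ : (fun z => _) = fun=> 0) ?big_nil ?derive1_cst//.
  by apply/funext => w; rewrite big_nil.
rewrite (_ : (fun z => _) = fun z => F i z + \sum_(i <- s) F i z); last first.
  by apply/funext => w; rewrite big_cons.
by rewrite big_cons -IH !derive1E (deriveD (hF i z zD) (@holomorphic_sum _ s _ hF z zD)).
Qed.

Lemma derive1Ml (k : C) F z : holomorphic F -> D z ->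
  derive1 (fun w => k * F w) z = k * derive1 F z.
Proof.
move=> hF zD; rewrite (derive1M (@holomorphic_cst k) hF zD).
by rewrite derive1_cst mul0r add0r.
Qed.

Lemma derive1n_leibniz m l h z : holomorphic l -> holomorphic h -> D z ->
  derive1n m (fun w => l w * h w) z =
  \sum_(k < m.+1) 'C(m, k)%:R * (derive1n (m - k) l z * derive1n k h z).
Proof.
move=> hl hh; elim: m z => [|m IH] z zD.
  by rewrite big_ord_recl big_ord0 /= bin0 mul1r addr0.
rewrite [LHS](_ : _ = derive1 (derive1n m (fun w => l w * h w)) z)//.
have hlh (k : 'I_m.+1) := holomorphicM (@holomorphic_derive1n l (m - k) hl) (@holomorphic_derive1n h k hh).
have hterm (k : 'I_m.+1) := holomorphicM (@holomorphic_cst 'C(m, k)%:R) (hlh k).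
rewrite (eq_derive1_disc IH zD) (derive1_sum _ hterm zD).
pose a k := derive1n k l z; pose b k := derive1n k h z.
have dterm (k : 'I_m.+1) : derive1 (fun w => 'C(m, k)%:R *
      (derive1n (m - k) l w * derive1n k h w)) z =
    'C(m, k)%:R * (a (m.+1 - k)%N * b k) + 'C(m, k)%:R * (a (m - k)%N * b k.+1).
  rewrite (derive1Ml _ (hlh k) zD).
  rewrite (derive1M (@holomorphic_derive1n l (m - k) hl) (@holomorphic_derive1n h k hh) zD).
  by rewrite /a /b subSn ?leq_ord// mulrDr.
rewrite (eq_bigr _ (fun k _ => dterm k)) big_split /=.
exact: (pascal_convolution m a b).
Qed.

(** The test [k == i] keeps every product over the whole of [s], the shape of the terms of a
    determinant; it singles out one factor because [s] is [uniq]. *)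
Lemma derive1_prod (I : eqType) (s : seq I) (F : I -> C -> C) z : uniq s ->
  (forall i, holomorphic (F i)) -> D z ->
  derive1 (fun w => \prod_(i <- s) F i w) z =
  \sum_(i <- s) \prod_(k <- s) (if k == i then derive1 (F k) z else F k z).
Proof.
move=> us hF zD; elim: s us => [_|x s IH /= /andP[xs us]].
  rewrite big_nil (_ : (fun w => _) = fun=> 1) ?derive1_cst//.
  by apply/funext => w; rewrite big_nil.
rewrite (_ : (fun z => _) = fun z => F x z * \prod_(i <- s) F i z); last first.
  by apply/funext => w; rewrite big_cons.
rewrite (derive1M (hF x) (@holomorphic_prod _ s _ hF) zD).
rewrite !big_cons eqxx; congr (_ + _).
  congr (_ * _); apply: eq_big_seq => k ks; case: eqP => // kx.
  by rewrite -kx ks in xs.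
rewrite IH// mulr_sumr; apply: eq_big_seq => i si; rewrite big_cons.
by case: eqP => // xi; rewrite xi si in xs.
Qed.

(** Rows are differentiated because factor i of each term of [determinant] lies in row i.
    Wronskians, which are built by columns, are transposed before this is applied. *)
Lemma derive1_det m (M : C -> 'M[C]_m) z :
  (forall i j, holomorphic (fun z => M z i j)) -> D z ->
  derive1 (fun w => \det (M w)) z =
  \sum_(k < m) \det (\matrix_(i, j) if i == k then derive1 (fun w => M w i j) z else M z i j).
Proof.
move=> hM zD; have hp (s : {perm 'I_m}) := @holomorphic_prod _ (index_enum 'I_m) _ (fun i => hM i (s i)).
have ht (s : {perm 'I_m}) := holomorphicM (@holomorphic_cst ((-1) ^+ s)) (hp s).
rewrite /determinant (derive1_sum _ ht zD).
rewrite [RHS]exchange_big /=; apply: eq_bigr => s _.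
rewrite (derive1Ml _ (hp s) zD).
rewrite (derive1_prod (index_enum_uniq _) (fun i => hM i (s i)) zD) mulr_sumr; apply: eq_bigr => k _.
by congr (_ * _); apply: eq_bigr => i _; rewrite mxE.
Qed.

Lemma derivable_coord m (F : C -> 'cV[C]_m) i z :
  derivable F z 1 -> derivable (fun w => F w i 0) z 1.
Proof.
move=> /cvg_ex[/= v Fv]; apply/cvg_ex; exists (v i 0).
have := cvg_comp _ _ Fv (@coord_continuous C m 1 i 0 v).
by apply: cvg_trans; apply: near_eq_cvg; near=> h; rewrite /= !mxE.
Unshelve. all: by end_near. Qed.

(** Expansion in the canonical basis reduces convergence of columns to that of scalars. *)
Lemma is_derive_col m (F : 'I_m -> C -> C) z : (forall i, derivable (F i) z 1) ->
  is_derive z 1 (fun w => \col_i F i w) (\col_i 'D_1 (F i) z).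
Proof.
move=> dF.
have colE (u : 'I_m -> C) : \col_i u i = \sum_i u i *: (delta_mx i 0 : 'cV[C]_m).
  apply/colP => i; rewrite !mxE summxE (bigD1 i)//= big1.
    by rewrite !mxE !eqxx mulr1 addr0.
  by move=> j ji; rewrite !mxE eq_sym (negbTE ji) mulr0.
pose q i (h : C) : C := h^-1 *: (F i (h *: 1 + z) - F i z).
have qE (h : C) : h^-1 *: ((\col_i F i (h *: 1 + z)) - (\col_i F i z)) =
    \sum_i q i h *: (delta_mx i 0 : 'cV[C]_m).
  rewrite -(colE (fun i => q i h)).
  by apply/colP => i; rewrite !mxE.
have cv : h^-1 *: ((\col_i F i (h *: 1 + z)) - (\col_i F i z)) @[h --> 0^']
    --> (\col_i 'D_1 (F i) z : 'cV[C]_m).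
  under eq_cvg do rewrite qE.
  rewrite colE; apply: cvg_big => [|i _]; last by apply: cvgZr_tmp; exact: dF.
  exact: add_continuous.
by apply: DeriveDef; [apply/cvg_ex; eexists; exact: cv | apply/cvg_lim].
Qed.

Lemma derive1n_col m (F : C -> 'cV[C]_m) k z : holomorphic F -> D z ->
  derive1n k F z = \col_i derive1n k (fun w => F w i 0) z.
Proof.
move=> hF; elim: k z => [|k IH] z zD; first by apply/colP => i; rewrite mxE.
rewrite [LHS](_ : _ = derive1 (derive1n k F) z)// (eq_derive1_disc IH zD) derive1E.
have dF i : derivable (derive1n k (fun w => F w i 0)) z 1.
  by apply: holomorphic_derive1n zD => w wD; exact/derivable_coord/hF.
have := is_derive_col dF => /(@derive_val _ _ _ _ _ _ _) ->.
by apply/colP => i; rewrite [LHS]mxE [RHS]mxE -derive1E derive1nS.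
Qed.

End HolomorphicCalculus.

(** * Determinants of dependent columns *)

Section ColumnDeterminants.
Variables (K : comNzRingType) (n : nat).
Implicit Types (v : nat -> 'cV[K]_n.+1) (c : nat -> K).

Definition cols p v : 'M[K]_(n.+1, p) := \matrix_(i, k) v k i 0.

(** The identity followed by the column (c_0, ..., c_(n-1), 0); the final 0 records that v_(n+1) has
    no component along v_n. *)
Definition dependence_mx c : 'M[K]_(n.+1, n.+2) :=
  \matrix_(i, m) if (m <= n)%N then (i == m :> nat)%:R
                 else if (i < n)%N then c i else 0.

Lemma cols_dependence v c : v n.+1 = \sum_(k < n) c k *: v k ->
  cols n.+2 v = cols n.+1 v *m dependence_mx c.
Proof.
move=> vE; apply/matrixP => i m; rewrite !mxE; have [mn|mn] := leqP m n.
  rewrite (bigD1 (Ordinal (mn : (m < n.+1)%N)))//= !mxE /= mn eqxx mulr1 big1 ?addr0//.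
  move=> k km; rewrite !mxE mn; case: eqP => // e; last by rewrite mulr0.
  by case/eqP: km; apply/val_inj.
have -> : m = n.+1 :> nat by apply/eqP; rewrite eqn_leq mn andbT -ltnS ltn_ord.
rewrite vE summxE big_ord_recr /= !mxE leqNgt mn /= ltnn mulr0 addr0.
apply: eq_bigr => k _; rewrite !mxE leqNgt mn /= ltn_ord mulrC; congr (_ * _).
Qed.

(** Once column j is deleted, row j keeps a single nonzero candidate, [c j] in the last column. Its
    minor is the identity and its sign (-1)^(j+n) equals (-1)^(n-j). *)
Lemma det_dependence_col' c (j : 'I_n) :
  \det (col' (inord j : 'I_n.+2) (dependence_mx c)) = (-1) ^+ (n - j) * c j.
Proof.
have jn : (j < n)%N by [].
have bumpS h q : (bump h q <= q.+1)%N.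
  by rewrite /bump; case: (h <= q)%N; rewrite ?add1n ?add0n.
have jE : (inord j : 'I_n.+2) = j :> nat by rewrite inordK// ltnW// ltnS ltnW.
have aE : (inord j : 'I_n.+1) = j :> nat by rewrite inordK// ltnS ltnW.
rewrite (expand_det_row _ (inord j : 'I_n.+1)) (bigD1 ord_max)//= big1 ?addr0.
  rewrite !mxE /= /bump jE aE (ltnW jn) /= add1n ltnn jn.
  rewrite /cofactor aE /= (_ : row' _ _ = 1%:M) ?det1 ?mulr1.
    by rewrite mulrC -signr_odd -[in RHS]signr_odd oddB ?(ltnW jn)// oddD addbC.
  apply/matrixP => p q; rewrite !mxE /= jE aE.
  have -> : bump n q = q by rewrite /bump leqNgt ltn_ord.
  have -> : (bump j q <= n)%N := leq_trans (bumpS j q) (ltn_ord q).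
  by rewrite (inj_eq (can_inj (bumpK j))).
move=> m mn; rewrite !mxE /= jE aE.
have mn' : (m < n)%N.
  by rewrite ltn_neqAle -ltnS ltn_ord andbT; apply: contra mn => /eqP e; apply/eqP/val_inj.
have -> : (bump j m <= n)%N := leq_trans (bumpS j m) mn'.
by rewrite (negbTE (neq_bump _ _)) mul0r.
Qed.

Lemma det_col'_dependence v c (j : 'I_n) : v n.+1 = \sum_(k < n) c k *: v k ->
  \det (col' (inord j : 'I_n.+2) (cols n.+2 v)) =
  (-1) ^+ (n - j) * c j * \det (cols n.+1 v).
Proof.
move=> /cols_dependence ->.
have -> : col' (inord j : 'I_n.+2) (cols n.+1 v *m dependence_mx c) =
    cols n.+1 v *m col' (inord j : 'I_n.+2) (dependence_mx c).
  by apply/matrixP => i k; rewrite !mxE; apply: eq_bigr => l _; rewrite !mxE.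
by rewrite det_mulmx det_dependence_col' mulrC.
Qed.

Definition skip_cols v : 'M[K]_n.+1 := cols n.+1 (fun k => if (k < n)%N then v k else v n.+1).

(** As the determinant is 1, the adjugate is the inverse and gives the coordinates of v_(n+1). The
    last coordinate, expanded along the last column, is the determinant of [skip_cols]. *)
Lemma cramer_dependence v : \det (cols n.+1 v) = 1 -> \det (skip_cols v) = 0 ->
  v n.+1 = \sum_(k < n) (\adj (cols n.+1 v) *m v n.+1) (inord k) 0 *: v k.
Proof.
move=> d1 d0; set x := \adj _ *m _.
have xmax : x ord_max 0 = 0.
  rewrite -d0 (expand_det_col _ ord_max) mxE; apply: eq_bigr => i _.
  rewrite !mxE /= ltnn mulrC; congr (_ * _); rewrite /cofactor; congr (_ * \det _).
  apply/matrixP => p q; rewrite !mxE /=.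
  have -> : bump n q = q by rewrite /bump leqNgt ltn_ord.
  by rewrite ltn_ord.
have <- : cols n.+1 v *m x = v n.+1 by rewrite mulmxA mul_mx_adj d1 mul1mx.
apply/colP => i; rewrite mxE big_ord_recr /= xmax mulr0 addr0 summxE.
apply: eq_bigr => k _; rewrite [RHS]mxE mulrC [cols _ _ _ _]mxE /=.
congr (x _ _ * _).
by apply/val_inj; rewrite /= inordK// ltnS ltnW.
Qed.

End ColumnDeterminants.

(** * Schwarzian curvatures *)

Section Curvatures.
Variables (R : realType) (n : nat).
Notation C := (Cplx R).
Notation D := (unit_disc R).
Implicit Types (l : C -> C) (F G : C -> 'cV[C]_n.+1) (z w : C).

Lemma derive1_eq_cst (h : C -> C) (c : C) z :
  (forall w, D w -> h w = c) -> D z -> derive1 h z = 0.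
Proof. by move=> hc zD; rewrite (@eq_derive1_disc R _ h (cst c) hc z zD) derive1_cst. Qed.

Lemma derive1n_coord F k i z : holomorphic F -> D z ->
  derive1n k F z i 0 = derive1n k (fun w => F w i 0) z.
Proof. by move=> hF zD; rewrite (derive1n_col k hF zD) mxE. Qed.

Lemma holomorphic_coord F i : holomorphic F -> holomorphic (fun w => F w i 0).
Proof. by move=> hF z zD; apply: derivable_coord; exact: hF. Qed.

Lemma holomorphic_derive1n_coord F k i : holomorphic F ->
  holomorphic (fun w => derive1n k F w i 0).
Proof.
move=> hF; apply: (@eq_holomorphic_disc R _ (derive1n k (fun w => F w i 0))).
  by move=> w wD; rewrite (derive1n_coord k i hF wD).
exact: (@holomorphic_derive1n R _ k (@holomorphic_coord F i hF)).
Qed.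

Lemma derive1_derive1n_coord F k i z : holomorphic F -> D z ->
  derive1 (fun w => derive1n k F w i 0) z = derive1n k.+1 F z i 0.
Proof.
move=> hF zD; rewrite (derive1n_coord k.+1 i hF zD) derive1nS.
by apply: eq_derive1_disc => // w wD; exact: derive1n_coord.
Qed.

Lemma holomorphicZ l F : holomorphic l -> holomorphic F ->
  holomorphic (fun w => l w *: F w).
Proof.
move=> hl hF z zD.
have -> : (fun w => l w *: F w) = fun w => \col_i (l w * F w i 0).
  by apply/funext => w; apply/colP => i; rewrite !mxE.
have dlF i : derivable (fun w => l w * F w i 0) z 1.
  exact: (@holomorphicM R _ _ hl (@holomorphic_coord F i hF) z zD).
by have [] := is_derive_col dlF.
Qed.

Lemma derive1nZ m l F z : holomorphic l -> holomorphic F -> D z ->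
  derive1n m (fun w => l w *: F w) z =
  \sum_(k < m.+1) ('C(m, k)%:R * derive1n (m - k) l z) *: derive1n k F z.
Proof.
move=> hl hF zD; apply/colP => i.
rewrite (derive1n_coord m i (@holomorphicZ l F hl hF) zD).
have -> : (fun w => (l w *: F w) i 0) = fun w => l w * F w i 0.
  by apply/funext => w; rewrite mxE.
rewrite (derive1n_leibniz m hl (@holomorphic_coord F i hF) zD) summxE.
by apply: eq_bigr => k _; rewrite mxE (derive1n_coord k i hF zD) mulrA.
Qed.

(** By the Leibniz rule the new Wronskian matrix is the old one times an upper triangular matrix
    whose diagonal entries are all [l z]. *)
Lemma det_wronskianZ l F z : holomorphic l -> holomorphic F -> D z ->
  \det (wronskian_mx (fun w => l w *: F w) z) = l z ^+ n.+1 * \det (wronskian_mx F z).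
Proof.
move=> hl hF zD.
pose U : 'M[C]_n.+1 := \matrix_(k, m)
  if (k <= m)%N then 'C(m, k)%:R * derive1n (m - k) l z else 0.
have -> : wronskian_mx (fun w => l w *: F w) z = wronskian_mx F z *m U.
  apply/matrixP => i m; rewrite !mxE (derive1nZ m hl hF zD) summxE.
  rewrite (big_ord_widen n.+1 (fun k => (('C(m, k)%:R * derive1n (m - k) l z) *:
    derive1n k F z) i 0))// big_mkcond /=; apply: eq_bigr => k _.
  by rewrite !mxE ltnS; case: ifP => _; rewrite ?mulr0// mulrC.
rewrite det_mulmx mulrC; congr (_ * _).
rewrite -det_tr det_trig; last first.
  apply/is_trig_mxP => i k ik; rewrite !mxE leqNgt.
  by have -> : (i < k)%N = true by exact: ik.
rewrite (eq_bigr (fun=> l z)) ?prodr_const ?card_ord// => i _.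
by rewrite !mxE leqnn binn mul1r subnn.
Qed.

Definition unimodular F := holomorphic F /\
  forall z, D z -> \det (wronskian_mx F z) = 1.

(** Differentiating row k < n of the transposed Wronskian repeats row k+1, so the derivative of the
    determinant reduces to the term k = n, the one stated. *)
Lemma det_skip_wronskian F z : unimodular F -> D z ->
  \det (skip_cols (fun k => derive1n k F z)) = 0.
Proof.
move=> [hF F1] zD; pose M w := (wronskian_mx F w)^T.
have ME w i j : M w i j = derive1n i F w j 0 by rewrite !mxE.
have MEf i j : (fun w => M w i j) = fun w => derive1n i F w j 0.
  by apply/funext => w; exact: ME.
have hM i j : holomorphic (fun w => M w i j).
  by rewrite MEf; exact: holomorphic_derive1n_coord.
have := derive1_det hM zD.
rewrite (_ : derive1 _ z = 0); last first.
  by apply: (derive1_eq_cst (c := 1)) zD => w wD; rewrite /M det_tr F1.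
rewrite (bigD1 ord_max)//= big1 ?addr0.
  move=> ->; rewrite -det_tr; congr (\det _); apply/matrixP => i j.
  rewrite [LHS]mxE [LHS]mxE [RHS]mxE MEf ME; have [->|im] := eqVneq i ord_max.
    by rewrite /= ltnn (derive1_derive1n_coord n j hF zD).
  have -> : (i < n)%N by rewrite ltn_neqAle -ltnS ltn_ord andbT; exact: im.
  by [].
move=> k km; have kn : (k < n)%N by rewrite ltn_neqAle -ltnS ltn_ord andbT; exact: km.
have kn1 : (k.+1 < n.+1)%N by [].
apply: (@determinant_alternate _ _ _ k (Ordinal kn1)) => [|j].
  by apply/eqP => /(congr1 val) /= /eqP; rewrite ltn_eqF.
rewrite [LHS]mxE [RHS]mxE eqxx ifN; last first.
  by apply/eqP => /(congr1 val) /= /eqP; rewrite gtn_eqF.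
by rewrite MEf ME (derive1_derive1n_coord k j hF zD).
Qed.

Definition curvature F k z : C :=
  (\adj (wronskian_mx F z) *m derive1n n.+1 F z) (inord k) 0.

Lemma curvature_eq F z : unimodular F -> D z ->
  derive1n n.+1 F z = \sum_(k < n) curvature F k z *: derive1n k F z.
Proof.
move=> uF zD; have [_ F1] := uF.
by apply: (@cramer_dependence C n (fun k => derive1n k F z));
  [exact: F1 | exact: det_skip_wronskian].
Qed.

(** Used with G = F and k = n+1 for the curvatures, and with k = 0 for the ratio of two lifts. *)
Lemma holomorphic_adj_wronskian F G k i : holomorphic F -> holomorphic G ->
  holomorphic (fun z => (\adj (wronskian_mx F z) *m derive1n k G z) i 0).
Proof.
move=> hF hG.
have -> : (fun z => (\adj (wronskian_mx F z) *m derive1n k G z) i 0) =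
    fun z => \sum_j (\adj (wronskian_mx F z)) i j * derive1n k G z j 0.
  by apply/funext => z; rewrite mxE.
apply: holomorphic_sum => j; apply: holomorphicM.
  apply: holomorphic_adj => a b.
  have -> : (fun z => wronskian_mx F z a b) = fun z => derive1n b F z a 0.
    by apply/funext => z; rewrite mxE.
  exact: holomorphic_derive1n_coord.
exact: holomorphic_derive1n_coord.
Qed.

(** The pointwise factors carry no regularity, so the ratio is read off instead as the first
    coordinate of [G] in the frame of derivatives of [F], which is holomorphic. Once mu' = 0, the
    Leibniz rule for mu F keeps only its last term. *)
Lemma unimodular_proportional F G : unimodular F -> unimodular G ->
  (forall z, D z -> exists c, G z = c *: F z) ->
  exists mu : C -> C, forall z, D z -> mu z != 0 /\
    forall k, derive1n k G z = mu z *: derive1n k F z.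
Proof.
move=> [hF F1] [hG G1] GF.
pose mu z := (\adj (wronskian_mx F z) *m G z) ord0 0.
have hmu : holomorphic mu := @holomorphic_adj_wronskian F G 0 ord0 hF hG.
have GE z : D z -> G z = mu z *: F z.
  move=> zD; have [c cE] := GF z zD; rewrite /mu cE -scalemxAr mxE.
  rewrite (_ : (\adj (wronskian_mx F z) *m F z) ord0 0 = 1) ?mulr1//.
  transitivity ((\adj (wronskian_mx F z) *m wronskian_mx F z) ord0 ord0).
    by rewrite !mxE; apply: eq_bigr => j _; rewrite [wronskian_mx _ _ _ _]mxE.
  by rewrite mul_adj_mx (F1 z zD) mxE eqxx.
have near_derive1n k : forall z, D z -> derive1n k G z = derive1n k (fun w => mu w *: F w) z.
  elim: k => [|k IH] z zD; first exact: GE.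
  by rewrite !derive1nS; exact: eq_derive1_disc IH z zD.
have mu1 z : D z -> mu z ^+ n.+1 = 1.
  move=> zD; rewrite -(G1 z zD) -[LHS]mulr1 -(F1 z zD) -(det_wronskianZ hmu hF zD).
  by congr (\det _); apply/matrixP => i k; rewrite !mxE near_derive1n.
have mu0 z : D z -> mu z != 0.
  by move=> zD; apply: contra_eq_neq (mu1 z zD) => ->; rewrite expr0n /= eq_sym oner_eq0.
have dmu z : D z -> derive1 mu z = 0.
  move=> zD; have : derive1 (fun w => mu w ^+ n.+1) z = 0.
    exact: (derive1_eq_cst mu1 zD).
  have dz : derivable mu z 1 := hmu z zD.
  rewrite derive1E (_ : (fun w => mu w ^+ n.+1) = mu ^+ n.+1); last first.
    by apply/funext => w; elim: n => [|m IH]; rewrite ?expr1// exprS IH [in RHS]exprS.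
  rewrite (deriveX n.+1 dz) -derive1E => /eqP; rewrite scaler_eq0 mulf_eq0 pnatr_eq0 /=.
  by rewrite expf_eq0 (negbTE (mu0 z zD)) andbF /= => /eqP.
have dmuk k z : D z -> derive1n k.+1 mu z = 0.
  elim: k z => [|k IH] z zD; first exact: dmu.
  by rewrite derive1nS; exact: (derive1_eq_cst IH zD).
exists mu => z zD; split; first exact: mu0.
move=> k; rewrite near_derive1n// (derive1nZ k hmu hF zD) big_ord_recr /= big1.
  by rewrite add0r binn mul1r subnn.
by move=> i _; rewrite /= -(subnSK (ltn_ord i)) (dmuk _ z zD) mulr0 scale0r.
Qed.

End Curvatures.

Theorem mainTheorem3 (R : realType) (n : nat) (n_ge1 : (1 <= n)%N)
    (Phi : Cplx R -> CP R n)
    (f : Cplx R -> 'cV[Cplx R]_n.+1) (lambda : Cplx R -> Cplx R)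
    (g : 'I_n.+1 -> Cplx R -> Cplx R)
    (f_lifts : admissible_lifting Phi f)
    (lambda_normalizes : normalizing_factor f lambda)
    (g_def : forall z, unit_disc R z ->
       derive1n n.+1 f z = \sum_(i < n.+1) g i z *: derive1n i f z) :
  forall (j : 'I_n) (z : Cplx R), unit_disc R z ->
    schwarzian_curvature Phi j z =
      (-1) ^+ (n - j) * \det (H_minor lambda g j z) * \det (wronskian_mx f z).
Proof.
have unimodular_lift f' lambda' : admissible_lifting Phi f' ->
    normalizing_factor f' lambda' -> unimodular (fun w => lambda' w *: f' w).
  move=> [[hf' _] _] [hl' l1]; split; first exact: holomorphicZ.
  by move=> w wD; rewrite (det_wronskianZ hl' hf' wD); exact: (l1 w wD).2.
pose nu w := lambda w *: f w.
have unu : unimodular nu := unimodular_lift f lambda f_lifts lambda_normalizes.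
have [[hf f_spans] _] := f_lifts; have [hl l1] := lambda_normalizes.
have : is_schwarzian_curvatures Phi (schwarzian_curvature Phi).
  apply: (@xgetPex _ _ [set kappa | is_schwarzian_curvatures Phi kappa]).
  exists (fun k => curvature nu k); split.
    by move=> k; apply: holomorphic_adj_wronskian; exact: unu.1.
  by exists f, lambda; split=> // w wD; exact: curvature_eq.
move=> [_ [f' [lambda' [f'_lifts lambda'_normalizes kappaE]]]] j z zD.
have unu' := unimodular_lift f' lambda' f'_lifts lambda'_normalizes.
have proportional w : unit_disc R w -> exists c, lambda' w *: f' w = c *: nu w.
  move=> wD; have [_ fw] := f_spans w wD; have [[_ f'_spans] _] := f'_lifts.
  have [_ f'w] := f'_spans w wD.
  have : f' w \in <[f w]>%VS by rewrite -fw f'w memv_line.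
  (* Both lifts span the line [Phi w], so f' w = c f w; dividing by [lambda w] passes from [f] to
     [nu]. *)
  move=> /vlineP[c ->]; exists (lambda' w * c / lambda w).
  by rewrite /nu !scalerA divfK//; exact: (l1 w wD).1.
have [mu /(_ z zD)[mu0 muE]] := unimodular_proportional unu unu' proportional.
pose v k := derive1n k nu z.
(* The curvatures are extended to all of nat by 0, as [dependence_mx] expects; they are read at
   indices below n only. *)
pose c k := oapp (fun i : 'I_n => schwarzian_curvature Phi i z) 0 (insub k).
have cE (k : 'I_n) : c k = schwarzian_curvature Phi k z by rewrite /c valK.
have vE : v n.+1 = \sum_(k < n) c k *: v k.
  (* The chosen curvatures satisfy the relation for their own lift, which is [mu] times the relation
     for [nu]. *)
  apply: (scalerI mu0); rewrite -muE kappaE// scaler_sumr.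
  by apply: eq_bigr => k _; rewrite muE cE !scalerA mulrC.
have colsE : cols n.+2 v = wronskian_mx f z *m H_mx lambda g z.
  apply/matrixP => i m; rewrite [LHS]mxE /v (derive1nZ m hl hf zD).
  rewrite summxE [RHS]mxE; have [mn|mn] := leqP m n.
    rewrite (big_ord_widen n.+1 (fun k => (('C(m, k)%:R * derive1n (m - k) lambda z) *:
      derive1n k f z) i 0))// big_mkcond /=; apply: eq_bigr => k _.
    by rewrite !mxE mn ltnS; case: ifP => _; rewrite ?mulr0// mulrC.
  have -> : m = n.+1 :> nat by apply/eqP; rewrite eqn_leq mn andbT -ltnS ltn_ord.
  (* The top Leibniz term is lambda f^(n+1); expanding it by [g_def] produces the summand lambda g_i
     in the last column of H. *)
  rewrite big_ord_recr /= subnn binn mul1r -derive1nS g_def// scaler_sumr.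
  rewrite [X in _ + X]summxE -big_split /=; apply: eq_bigr => k _.
  by rewrite !mxE leqNgt mn /= [RHS]mulrC mulrDl -(mulrA (lambda z)).
have := @det_col'_dependence _ n v c j vE; rewrite colsE.
have -> : \det (cols n.+1 v) = 1 by exact: unu.2.
have -> : col' (inord j : 'I_n.+2) (wronskian_mx f z *m H_mx lambda g z) =
    wronskian_mx f z *m H_minor lambda g j z.
  by apply/matrixP => i k; rewrite !mxE; apply: eq_bigr => l _; rewrite !mxE.
rewrite det_mulmx mulr1 -(cE j) -mulrA => /(congr1 ( *%R ((-1) ^+ (n - j)))).
by rewrite mulrA -expr2 sqrr_sign mul1r => <-; rewrite [X in _ * X]mulrC.
Qed.
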